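(* Let $d\ge2$ be a constant integer. Then every deterministic SQ distance approximation algorithm for halfspaces under $\mathcal{N}(0,I)$ on $\mathbb{R}^d$ that uses a bounded number of bits of advice requires $(1/\epsilon)^{\Omega(d)}$ queries to $\mathrm{STAT}(\epsilon^{\Omega(d)})$.
   Context: $\mathcal{H}$ is the class of halfspaces over $\mathbb{R}^d$ viewed as $\{\pm1\}$-valued functions $x\mapsto\mathrm{sign}(\langle w,x\rangle+\theta)$; $\mathrm{dist}_{\mathcal{N}(0,I)}(f,\mathcal{H})=\inf_{h\in\mathcal{H}}\Pr_{x\sim\mathcal{N}(0,I)}[f(x)\ne h(x)]$. Given tolerance $\tau$ and a query $q:\mathbb{R}^d\times[-1,1]\to[-1,1]$, the oracle $\mathrm{STAT}(\tau)$ returns some $v$ with $|\mathbb{E}_{x\sim\mathcal{N}(0,I)}[q(x,f(x))]-v|\le\tau$ (answers may be adversarial within this tolerance). An SQ distance approximation algorithm for halfspaces under $\mathcal{N}(0,I)$ accesses $f:\mathbb{R}^d\to\{\pm1\}$ only via the oracle and, given $\epsilon$, outputs $\widehat\alpha$ with $|\mathrm{dist}_{\mathcal{N}(0,I)}(f,\mathcal{H})-\widehat\alpha|\le\epsilon$. $\Omega(d)$ denotes $cd$ for an absolute constant $c>0$. *)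

(* Defs.v *)
From HB Require Import structures.
From mathcomp Require Import all_boot all_order all_algebra.
From mathcomp Require Import all_classical all_reals all_analysis.

Set Implicit Arguments.
Unset Strict Implicit.
Unset Printing Implicit Defensive.

Import Order.TTheory GRing.Theory Num.Theory.
Import numFieldNormedType.Exports.

Local Open Scope classical_set_scope.
Local Open Scope ring_scope.

(* R^n is represented by n.-tuple R, which carries the product sigma-algebra
   (i.e. the Borel sets of R^n). *)

Section std_gaussian.
Variable R : realType.

(* normal_prob lives on measurableTypeR R, which is R with the same Borel sets but
   another measure_display than the one inherited by n.-tuple R. *)
Definition tuple_cons n (p : measurableTypeR R * n.-tuple R) : n.+1.-tuple R :=
  [tuple of p.1 :: p.2].

Lemma measurable_tuple_cons n : measurable_fun setT (@tuple_cons n).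
Proof. by apply: measurable_cons => /=; [exact: measurable_fst|exact: measurable_snd]. Qed.

HB.instance Definition _ n :=
  isMeasurableFun.Build _ _ _ _ (@tuple_cons n) (@measurable_tuple_cons n).

(* N(0, I_n), i.e. the law of n independent N(0, 1) coordinates; the parameters
   of normal_prob are the mean and the standard deviation. *)
Fixpoint std_gaussian n : probability (n.-tuple R) R :=
  match n with
  | 0 => \d_[tuple]
  | n'.+1 => distribution (normal_prob (0 : R) (1 : R) \x std_gaussian n')%E
                          (@tuple_cons n')
  end.

End std_gaussian.

Section halfspaces.
Variables (R : realType) (n : nat).
Implicit Types (f : n.-tuple R -> R).

(* sign(0) = 1, so that halfspaces are {-1, 1}-valued. *)
Definition halfspace (w : n.-tuple R) (theta : R) : n.-tuple R -> R :=
  fun x => if 0 <= \sum_(i < n) tnth w i * tnth x i + theta then 1 else -1.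

Definition halfspaces : set (n.-tuple R -> R) :=
  [set h | exists w theta, h = halfspace w theta].

Definition dist_halfspaces f : R :=
  inf [set fine (std_gaussian R n [set x | f x <> h x]) | h in halfspaces].

Definition sign_valued f := forall x, f x = 1 \/ f x = -1.

End halfspaces.

Section statistical_queries.
Variables (R : realType) (n : nat).
Implicit Types (f : n.-tuple R -> R).

(* Functions R^n x [-1, 1] -> [-1, 1]; values at (x, y) with `|y| > 1 are junk. *)
Record sq_query := SQQuery {
  sq_fun :> n.-tuple R * R -> R;
  sq_fun_measurable : measurable_fun [set p : n.-tuple R * R | p.2 \in `[-1, 1]] sq_fun;
  sq_fun_bounded :
    forall x (y : R), y \in `[-1, 1] -> sq_fun (x, y) \in `[-1, 1]
}.

Definition stat_answer (tau : R) f (q : sq_query) (v : R) : Prop :=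
  `| \int[std_gaussian R n]_x q (x, f x) - v | <= tau.

(* A deterministic adaptive algorithm, as a decision tree: stop with an output,
   or make a query and continue according to the real number answered. *)
Inductive sq_alg :=
| Output of R
| Query of sq_query & (R -> sq_alg).

(* sq_run tau f A out m: for some admissible answers of the oracle STAT(tau) on
   the unknown function f, the algorithm A makes m queries and outputs out. *)
Inductive sq_run (tau : R) f : sq_alg -> R -> nat -> Prop :=
| RunOutput out : sq_run tau f (Output out) out 0
| RunQuery q next v out m :
    stat_answer tau f q v ->
    sq_run tau f (next v) out m ->
    sq_run tau f (Query q next) out m.+1.

(* A is an algorithm with b bits of advice. The advice may depend on the unknown
   function f, whereas the oracle answers are adversarial. *)
Definition sq_dist_approx (b : nat) (A : b.-tuple bool -> sq_alg)
    (eps tau : R) (N : nat) : Prop :=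
  forall f, measurable_fun setT f -> sign_valued f ->
    exists advice : b.-tuple bool,
      forall out m, sq_run tau f (A advice) out m ->
        `| dist_halfspaces f - out | <= eps /\ (m <= N)%N.

End statistical_queries.

(* Main.v *)
(* Let sq u = (-1) ^ floor u.  For an integer vector w = (K, v) the function
   x |-> sq <w, x> is, on the bulk of the Gaussian, an alternating sum of O(K)
   halfspaces, so (up to sign) it agrees with one of them with probability at
   least 1/2 + c/K; since the shift by 1/K in the first coordinate flips it, no
   halfspace does better than 1/2 + 1/K.  So the distance to halfspaces reveals
   the order of magnitude of K.

   For fixed K and varying v these waves are orthonormal on the torus
   (R / 2Z)^d, because some translation fixes one of two given waves and flips the
   other; the Gaussian is dominated, modulo 2Z^d, by 8^d times the uniform measure,
   whence a Bessel inequality under the Gaussian.  So a query notices only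
   O(1/tau^2) of the K^(d-1) waves, and (1/eps)^(d/8) queries miss some wave at
   each of 2^b + 1 scales K of order 1/eps.  Answering every query as for a random
   sign is then admissible for one wave per scale; two of these waves receive the
   same advice, yet their distances differ by more than 2 eps. *)
From HB Require Import structures.
Require Import Defs.
From mathcomp Require Import all_boot all_order all_algebra.
From mathcomp Require Import all_classical all_reals all_analysis measurable_realfun.
From mathcomp Require Import ring lra zify.

Set Implicit Arguments.
Unset Strict Implicit.
Unset Printing Implicit Defensive.

Import Order.TTheory GRing.Theory Num.Theory.
Import numFieldNormedType.Exports.

Local Open Scope classical_set_scope.
Local Open Scope ring_scope.

(** * Translations of Lebesgue and Gaussian measure *)

Section translation.
Variable R : realType.
Local Notation mu := (@lebesgue_measure R).
Local Notation TR := (measurableTypeR R).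

Definition addR (s : R) : TR -> TR := fun x => x + s.

Lemma measurable_addR s : measurable_fun setT (addR s).
Proof. by apply: measurable_funD. Qed.

HB.instance Definition _ s :=
  isMeasurableFun.Build _ _ _ _ (addR s) (@measurable_addR s).

(** Lebesgue measure is determined by its values on half-open intervals, and translation preserves
    their length. *)
Lemma lebesgue_measure_addR (s : R) (A : set TR) : measurable A ->
  mu A = pushforward mu (addR s) A.
Proof.
move=> mA.
apply: (@lebesgue_measure_unique R (pushforward mu (addR s))) => // X [[a b] /= _ <-].
rewrite /pushforward.
rewrite (_ : addR s @^-1` _ = `]a - s, b - s]%classic); last first.
  by apply/seteqP; split => x /=; rewrite /addR !in_itv /=; lra.
rewrite !lebesgue_measure_itv /= !lte_fin ltrD2r.
by case: ifP => // _; rewrite -!EFinB; congr EFin; lra.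
Qed.

Lemma ge0_integral_addR (s : R) (D : set TR) (f : TR -> \bar R) :
  measurable D -> measurable_fun D f -> (forall x, D x -> 0 <= f x)%E ->
  (\int[mu]_(x in D) f x = \int[mu]_(x in addR s @^-1` D) f (addR s x))%E.
Proof.
move=> mD mf f0.
rewrite (_ : integral mu D f = integral (pushforward mu (addR s)) D f).
  by rewrite ge0_integral_pushforward// => x /[!inE]; exact: f0.
by apply: eq_measure_integral => A mA _; exact: lebesgue_measure_addR.
Qed.

End translation.


(** * Real-valued probabilities *)

Section prob_real.
Context d (T : measurableType d) (R : realType) (P : probability T R).

Definition pr (A : set T) : R := fine (P A).

Lemma prE A : measurable A -> (pr A)%:E = P A.
Proof. by move=> mA; rewrite /pr fineK// fin_num_measure. Qed.

Lemma pr_ge0 A : 0 <= pr A.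
Proof. exact: fine_ge0. Qed.

Lemma pr_le1 A : measurable A -> pr A <= 1.
Proof. by move=> mA; rewrite -lee_fin prE// probability_le1. Qed.

Lemma pr_le A B : measurable A -> measurable B -> A `<=` B -> pr A <= pr B.
Proof. by move=> mA mB AB; rewrite -lee_fin !prE// le_measure// inE. Qed.

Lemma pr_setD A B : measurable A -> measurable B -> pr A = pr (A `\` B) + pr (A `&` B).
Proof.
move=> mA mB; apply: EFin_inj; rewrite EFinD !prE//; last 2 first.
- exact: measurableI.
- exact: measurableD.
exact: measureDI.
Qed.

Lemma pr_setU A B : measurable A -> measurable B ->
  pr (A `|` B) + pr (A `&` B) = pr A + pr B.
Proof.
move=> mA mB; rewrite (@pr_setD (A `|` B) B)//; last exact: measurableU.
rewrite setDUl setDv setU0 (pr_setD mA mB) (_ : (A `|` B) `&` B = B); first lra.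
by apply/seteqP; split => [x []|x Bx]//; split => //; right.
Qed.

Lemma pr_setC A : measurable A -> pr (~` A) = 1 - pr A.
Proof.
move=> mA; apply: EFin_inj; rewrite EFinB !prE//; last exact: measurableC.
by rewrite probability_setC.
Qed.

End prob_real.

(** Abstracts every probability to a real variable, so that [lra] is left with a purely linear
    problem. *)
Ltac pr_lra :=
  repeat match goal with |- context [pr ?P ?A] => move: (pr P A) end;
  clear; intros; lra.

Section normal_shift.
Variable R : realType.
Local Notation mu := (@lebesgue_measure R).
Local Notation TR := (measurableTypeR R).
Local Notation gamma := (normal_prob (0 : R) (1 : R)).
Local Notation phi := (normal_pdf (0 : R) (1 : R)).

Lemma normal_prob_addR (s : R) (A : set TR) : measurable A ->
  gamma (addR (- s) @^-1` A) = (\int[mu]_(x in A) (phi (x + s))%:E)%E.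
Proof.
move=> mA; rewrite /normal_prob (@ge0_integral_addR R s).
- rewrite -comp_preimage (_ : addR _ \o addR _ = idfun)//.
  by apply/funext => x /=; rewrite /addR addrK.
- by rewrite -[X in measurable X]setTI; apply: measurable_addR.
- by apply/measurable_EFinP/measurable_funTS; exact: measurable_normal_pdf.
- by move=> x _; rewrite lee_fin normal_pdf_ge0.
Qed.

Lemma measurable_normal_pdf_addR (s : R) (A : set TR) :
  measurable_fun A (fun x : TR => (phi (x + s))%:E).
Proof.
apply/measurable_EFinP/measurable_funTS.
apply: (measurableT_comp (measurable_normal_pdf _ _)).
exact: measurable_addR.
Qed.

(** The preimage has as its measure the integral over [A] of the translated density, so densities
    need only be compared pointwise on [A]. *)
Lemma normal_prob_shift_le (c s : R) (A : set TR) : measurable A -> 0 <= c ->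
  (forall x, A x -> phi x <= c * phi (x + s)) ->
  (gamma A <= c%:E * gamma (addR (- s) @^-1` A))%E.
Proof.
move=> mA c0 h; rewrite normal_prob_addR// -ge0_integralZl//; last 2 first.
- exact: measurable_normal_pdf_addR.
- by move=> x _; rewrite lee_fin normal_pdf_ge0.
apply: ge0_le_integral => //.
- by move=> x _; rewrite lee_fin normal_pdf_ge0.
- by apply/measurable_EFinP/measurable_funTS; exact: measurable_normal_pdf.
- by apply: measurable_funeM; exact: measurable_normal_pdf_addR.
Qed.

Lemma normal_pdf01E (x : R) :
  phi x = normal_peak 1 * expR (- x ^+ 2 / 2).
Proof. by rewrite normal_pdfE ?oner_eq0// /normal_fun subr0 expr1n. Qed.

Lemma normal_peak1_le1 : normal_peak 1 <= 1 :> R.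
Proof.
rewrite /normal_peak expr1n mul1r invf_le1.
  rewrite -[leLHS]sqrtr1 ler_wsqrtr//.
  by have := pi_ge2 R; lra.
by rewrite sqrtr_gt0 mulrn_wgt0// pi_gt0.
Qed.

Lemma normal_prob_itv_le (a b : R) : a <= b ->
  (gamma `[a, b] <= (b - a)%:E)%E.
Proof.
move=> ab; rewrite /normal_prob.
apply: (@le_trans _ _ (\int[mu]_(x in `[a, b]) 1%:E)%E).
  apply: ge0_le_integral => //.
  - by move=> x _; rewrite lee_fin normal_pdf_ge0.
  - by apply/measurable_EFinP/measurable_funTS; exact: measurable_normal_pdf.
  move=> x _; rewrite lee_fin (le_trans (normal_pdf_ub _ _ _)) ?oner_eq0//.
    exact: normal_peak1_le1.
rewrite integral_cst//= mul1e lebesgue_measure_itv /= lte_fin.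
by case: ifPn => // _; rewrite lee_fin subr_ge0.
Qed.

(* The density is larger at the end of the shift nearer to 0, so only the mass
   between -s/2 and s/2 can be lost. *)
Lemma normal_prob_shift_tv (s : R) (A : set TR) : measurable A -> 0 <= s ->
  (gamma A <= gamma (addR (- s) @^-1` A) + s%:E)%E.
Proof.

move=> mA s0.
have mS (B : set TR) : measurable B -> measurable (addR (- s) @^-1` B).
  by move=> mB; rewrite -[X in measurable X]setTI; apply: measurable_addR.
have mD : measurable ([set x | - s / 2 <= x] : set TR).
  by rewrite -set_itvcy; exact: measurable_itv.
set D : set TR := [set x | - s / 2 <= x] in mD.
have mDA : measurable (D `\` A) by exact: measurableD.
have mAD : measurable (A `\` D) by exact: measurableD.
have phi_le (x y : R) : y ^+ 2 <= x ^+ 2 -> phi x <= phi y.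
  move=> yx; rewrite !normal_pdf01E ler_wpM2l ?normal_peak_ge0// ler_expR; lra.
rewrite -!(prE gamma)//; last exact: mS.
rewrite -EFinD lee_fin.
(* Left of [- s / 2], adding [s] does not increase the distance to 0, so the density does not
   drop. *)
have h1 : pr gamma (A `\` D) <= pr gamma (addR (- s) @^-1` (A `\` D)).
  rewrite -lee_fin !prE//; last exact: mS.
  have := @normal_prob_shift_le 1 s (A `\` D) mAD ler01; rewrite mul1e; apply.
  by move=> x [_ /negP]; rewrite /D/= -ltNge => xs; rewrite mul1r phi_le//; nra.
(* On [D] the comparison of densities is reversed. It is applied to the complement of [A] in [D],
   and subtraction from the bound [h3] for [D] itself restores the direction. *)
have h2 : pr gamma (addR (- s) @^-1` (D `\` A)) <= pr gamma (D `\` A).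
  rewrite -lee_fin !prE//; last exact: mS.
  have := @normal_prob_shift_le 1 (- s) (addR (- s) @^-1` (D `\` A)) (mS _ mDA) ler01.
  rewrite mul1e -comp_preimage (_ : addR (- s) \o _ = idfun); last first.
    by apply/funext => x /=; rewrite /addR opprK addrK.
  apply; move=> x [] /=; rewrite /D /addR /= => xs _; rewrite mul1r phi_le//; nra.
have h3 : pr gamma D <= pr gamma (addR (- s) @^-1` D) + s.
  rewrite (@pr_setD _ _ _ gamma D (addR (- s) @^-1` D))//; last exact: mS.
  rewrite addrC; apply: lerD.
    apply: pr_le; [|exact: mS|by move=> x []].
    by apply: measurableI => //; exact: mS.
  have sE : s / 2 - - s / 2 = s by lra.
  rewrite -[leRHS]sE {sE}.
  rewrite -lee_fin prE; last by apply: measurableD => //; exact: mS.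
  have ss : - s / 2 <= s / 2 by lra.
  apply: (le_trans _ (normal_prob_itv_le ss)).
  apply: le_measure; rewrite ?inE//; first by apply: measurableD => //; exact: mS.
  move=> x [] /= h /negP; rewrite /D /addR/= -ltNge in_itv /= => h'.
  by move: h; rewrite /D /=; lra.
have e1 := @pr_setD _ _ _ gamma A D mA mD.
have e2 : pr gamma (addR (- s) @^-1` A) = pr gamma (addR (- s) @^-1` (A `\` D)) +
  pr gamma (addR (- s) @^-1` (A `&` D)) := pr_setD gamma (mS _ mA) (mS _ mD).
have e3 := pr_setD gamma mD mA.
have e4 : pr gamma (addR (- s) @^-1` D) = pr gamma (addR (- s) @^-1` (D `\` A)) +
  pr gamma (addR (- s) @^-1` (D `&` A)) := pr_setD gamma (mS _ mD) (mS _ mA).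
rewrite [D `&` A]setIC in e3 e4.
by move: h1 h2 h3 e1 e2 e3 e4; pr_lra.
Qed.

End normal_shift.

(** * The square wave *)

Section square_wave.
Variable R : realType.
Implicit Types (u v x : R).

(* The square wave (-1) ^ floor u. *)
Definition sqwave u : R :=
  if u / 2 - (Num.floor (u / 2))%:~R < 1 / 2 then 1 else -1.

Definition sgn u : R := if 0 <= u then 1 else -1.

Lemma sqwaveP u : sqwave u = 1 \/ sqwave u = -1.
Proof. by rewrite /sqwave; case: ifP; [left|right]. Qed.

Lemma sgnP u : sgn u = 1 \/ sgn u = -1.
Proof. by rewrite /sgn; case: ifP; [left|right]. Qed.

Lemma sqwaveE u (m : int) : m%:~R *+ 2 <= u < m%:~R *+ 2 + 2 ->
  sqwave u = if u < m%:~R *+ 2 + 1 then 1 else -1.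
Proof.
move=> /andP[mu um]; rewrite /sqwave (@floor_def _ _ m); last first.
  by rewrite intrD; apply/andP; split; lra.
by congr (if _ then _ else _); apply/idP/idP; lra.
Qed.

Lemma sqwave_bounds u : exists m : int, m%:~R *+ 2 <= u < m%:~R *+ 2 + 2.
Proof.
exists (Num.floor (u / 2)); have := floor_itv (u / 2); rewrite intrD; lra.
Qed.

Lemma sqwaveD1 u : sqwave (u + 1) = - sqwave u.
Proof.
have [m mu] := sqwave_bounds u; rewrite (sqwaveE mu).
have [um|um] := ltP u (m%:~R *+ 2 + 1).
  by rewrite (@sqwaveE _ m); [rewrite ifF//; apply/negbTE; lra|lra].
rewrite (@sqwaveE _ (m + 1)); last by rewrite intrD; lra.
by rewrite ifT ?opprK// intrD; lra.
Qed.

Lemma sqwaveDz u (m : int) : sqwave (u + m%:~R *+ 2) = sqwave u.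
Proof.
have [n nu] := sqwave_bounds u; rewrite (sqwaveE nu).
rewrite (@sqwaveE _ (n + m)); last by rewrite intrD; lra.
by congr (if _ then _ else _); rewrite intrD; apply/idP/idP; lra.
Qed.

Lemma measurable_sqwave : measurable_fun setT sqwave.
Proof.
have mf : measurable_fun setT (fun x : R => (Num.floor x)%:~R : R).
  apply: nondecreasing_measurable => // x y xy.
  by rewrite ler_int; exact: le_floor.
have mh : measurable_fun setT (fun x : R => x / 2).
  by apply: measurable_funM.
apply: measurable_fun_if => //.
apply: measurable_fun_ltr => //; apply: measurable_funB => //.
exact: (measurableT_comp mf mh).
Qed.

Lemma measurable_sgn : measurable_fun setT sgn.
Proof. by apply: measurable_fun_if => //; apply: measurable_fun_ler. Qed.

(** The two terms added by the induction step cancel except on [[2p+1, 2p+2)], where they sum to -2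
    and carve the next trough of the wave out of the tail 1. The number of terms is odd so that the
    tails are -1 and 1 rather than 0. *)
Lemma sum_alt_sgn p u :
  \sum_(i < p.*2.+1) (-1) ^+ i * sgn (u - i%:R) =
  if u < 0 then -1 else if p.*2.+1%:R <= u then 1 else sqwave u.
Proof.
elim: p => [|p IHp].
  rewrite big_ord_recr big_ord0 /= add0r expr0 mul1r subr0 /sgn.
  have [u0|//] := leP 0 u; have [//|u1] := leP (0.*2.+1%:R : R) u.
  rewrite double0 in u1; rewrite (@sqwaveE _ 0); first by rewrite ifT//; lra.
  by rewrite mulr0z; lra.
rewrite doubleS big_ord_recr big_ord_recr /= IHp !exprS -!mul2n exprM sqrrN !expr1n.
rewrite mul2n.
rewrite -(natr1 p.*2.+2) -(natr1 p.*2.+1).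
have pE : p.*2.+1%:R = p%:R *+ 2 + 1 :> R by rewrite -natr1 -muln2 natrM mulr_natr.
rewrite pE; set P : R := p%:R; have P0 : 0 <= P by rewrite /P.
have [u0|u0] := ltP u 0.
  by rewrite /sgn !ifF; [lra|apply/negbTE; lra|apply/negbTE; lra].
have sq1 : P *+ 2 + 1 <= u < P *+ 2 + 2 -> sqwave u = -1.
  by move=> h; rewrite (@sqwaveE u p) -/P; [rewrite ifF//; apply/negbTE; lra|lra].
have sq2 : P *+ 2 + 2 <= u < P *+ 2 + 3 -> sqwave u = 1.
  move=> h; rewrite (@sqwaveE u (p%:Z + 1)); last by rewrite intrD /= -/P; lra.
  by rewrite intrD /= -/P ifT//; lra.
rewrite /sgn !subr_ge0.
have [h1|h1] := leP (P *+ 2 + 1) u; last first.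
  by rewrite !ifF; [lra|apply/negbTE; lra|apply/negbTE; lra].
have [h2|h2] := leP (P *+ 2 + 1 + 1) u; last first.
  by rewrite ifF; [rewrite sq1; lra|apply/negbTE; lra].
have [h3|h3] := leP (P *+ 2 + 1 + 1 + 1) u; first lra.
by rewrite sq2; lra.
Qed.

End square_wave.

Section sqwave_halfline.
Variable R : realType.
Local Notation TR := (measurableTypeR R).
Local Notation gamma := (normal_prob (0 : R) (1 : R)).

Lemma measurable_eq_fun d (T : measurableType d) (f g : T -> R) :
  measurable_fun setT f -> measurable_fun setT g ->
  measurable [set x | f x = g x].
Proof.
move=> mf mg; have -> : [set x | f x = g x] = (f \- g) @^-1` [set 0].
  apply/seteqP; split => x /=; first by move=> ->; rewrite subrr.
  by move/eqP; rewrite subr_eq0 => /eqP.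
by rewrite -[X in measurable X]setTI; apply: (measurable_funB mf mg).
Qed.

(* Shifting x by 1 / K flips the wave but, off an interval of length 1 / K, not
   the sign. *)
Lemma sqwave_halfline (K a w c : R) : 0 < K ->
  pr gamma [set x | sqwave (K * x + a) = sgn (w * x + c)] <= 1 / 2 + 1 / K.
Proof.
move=> K0; set A : set TR := [set x | _].
pose s := 1 / K; have s0 : 0 < s by rewrite /s divr_gt0.
have maff (k b : R) : measurable_fun setT (fun x : TR => k * x + b).
  by apply: measurable_funD => //; apply: measurable_funM.
have mA : measurable A.
  apply: measurable_eq_fun.
    exact: (measurableT_comp (@measurable_sqwave R) (maff K a)).
  exact: (measurableT_comp (@measurable_sgn R) (maff w c)).
pose A' := addR (- s) @^-1` A.
have mA' : measurable A'.
  by rewrite -[X in measurable X]setTI; apply: measurable_addR.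
have h1 : pr gamma A <= pr gamma A' + s.
  by rewrite -lee_fin EFinD !prE//; exact: normal_prob_shift_tv (ltW s0).
(* On the intersection the wave changes sign between [x - s] and [x], hence so does the affine
   function, whose zero [- c / w] then lies within [s] of [x]. For [w = 0] there is no sign change
   and the intersection is empty. *)
have h2 : pr gamma (A `&` A') <= s.
  pose J : set TR := `[- c / w, - c / w + s]%classic.
  have mJ : measurable J by exact: measurable_itv.
  apply: (@le_trans _ _ (pr gamma J)).
    apply: pr_le => //; first exact: measurableI.
    move=> x []; rewrite /A' /A /J /addR /= in_itv /= => e1 e2.
    have := sqwaveD1 (K * (x - s) + a).
    have -> : K * (x - s) + a + 1 = K * x + a.
      by rewrite /s; field; rewrite gt_eqF.
    rewrite e1 e2 /sgn.
    have [->|w0] := eqVneq w 0; first by rewrite !mul0r; case: ifP => _; lra.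
    have : w * (c / w) = c by rewrite mulrCA divff// mulr1.
    rewrite mulNr; move: (c / w) => q qE; rewrite -qE.
    have [h|h] := ltP 0 w.
      by case: leP => ?; case: leP => ?; try lra; move=> _; apply/andP; split; nra.
    have {}h : w < 0 by rewrite lt_neqAle w0.
    by case: leP => ?; case: leP => ?; try lra; move=> _; apply/andP; split; nra.
  have h : - c / w <= - c / w + s by rewrite lerDl ltW.
  have := normal_prob_itv_le h; rewrite addrAC subrr add0r.
  by rewrite -(prE gamma)// lee_fin.
(* [A] and [A'] overlap in at most [s] and fit into total mass 1, while [A] exceeds [A'] by at most
   [s]; so twice the mass of [A] is at most [1 + 2 s]. *)
have h3 := pr_setU gamma mA mA'.
have h4 : pr gamma (A `|` A') <= 1 by apply: pr_le1; exact: measurableU.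
by move: h1 h2 h3 h4; rewrite -/s; pr_lra.
Qed.

End sqwave_halfline.

(** * Tonelli for measures on tuples *)

Section tuple_cons_integral.
Variables (R : realType) (n : nat).
Variables (P : probability (measurableTypeR R) R) (Q : probability (n.-tuple R) R).
Local Open Scope ereal_scope.

(** Stated for arbitrary factors so as to serve both the Gaussian and the torus, whose measures
    unfold to such a distribution. *)
Lemma ge0_integral_tuple_cons12 (f : n.+1.-tuple R -> \bar R) :
  measurable_fun setT f -> (forall x, 0 <= f x) ->
  \int[distribution (P \x Q) (@tuple_cons R n)]_z f z =
  \int[P]_x \int[Q]_y f (tuple_cons (x, y)).
Proof.
move=> mf f0; rewrite ge0_integral_distribution//.
rewrite fubini_tonelli1 => [//||x]; last exact: f0.
exact: (measurableT_comp mf (@measurable_tuple_cons R n)).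
Qed.

Lemma ge0_integral_tuple_cons21 (f : n.+1.-tuple R -> \bar R) :
  measurable_fun setT f -> (forall x, 0 <= f x) ->
  \int[distribution (P \x Q) (@tuple_cons R n)]_z f z =
  \int[Q]_y \int[P]_x f (tuple_cons (x, y)).
Proof.
move=> mf f0; rewrite ge0_integral_distribution//.
rewrite fubini_tonelli2 => [//||x]; last exact: f0.
exact: (measurableT_comp mf (@measurable_tuple_cons R n)).
Qed.

End tuple_cons_integral.

(** * Expectations of bounded measurable functions *)

Section bounded_measurable.
Context d (T : measurableType d) (R : realType) (P : probability T R).
Implicit Types f g : T -> R.

(** A class closed under sums and products and integrable for every probability, so that the
    linearity of [Ex] only asks for membership in it. *)
Definition bmf f := measurable_fun setT f /\ exists M : R, forall x, `|f x| <= M.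

Lemma bmf_cst (r : R) : bmf (cst r).
Proof. by split; [exact: measurable_cst|exists `|r|]. Qed.

Lemma bmfD f g : bmf f -> bmf g -> bmf (fun x => f x + g x).
Proof.
move=> [mf [M fM]] [mg [N gN]]; split; first exact: measurable_funD.
by exists (M + N) => x; rewrite (le_trans (ler_normD _ _))// lerD.
Qed.

Lemma bmfM f g : bmf f -> bmf g -> bmf (fun x => f x * g x).
Proof.
move=> [mf [M fM]] [mg [N gN]]; split; first exact: measurable_funM.
by exists (M * N) => x; rewrite normrM ler_pM.
Qed.

Lemma bmfZ (r : R) f : bmf f -> bmf (fun x => r * f x).
Proof. by move=> bf; apply: (bmfM (bmf_cst r)). Qed.

Lemma bmf_sum (I : Type) (s : seq I) (F : I -> T -> R) :
  (forall i, bmf (F i)) -> bmf (fun x => \sum_(i <- s) F i x).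
Proof.
move=> bF; elim: s => [|i s IHs].
  by rewrite [X in bmf X](_ : _ = cst 0) ?funeqE// => [|x]; [exact: bmf_cst|rewrite big_nil].
rewrite [X in bmf X](_ : _ = fun x => F i x + \sum_(j <- s) F j x).
  exact: bmfD.
by apply/funext => x; rewrite big_cons.
Qed.

Lemma bmf_pm1 f : measurable_fun setT f -> (forall x, f x = 1 \/ f x = -1) -> bmf f.
Proof.
move=> mf f1; split=> //; exists 1 => x.
by have [->|->] := f1 x; rewrite ?normrN normr1.
Qed.

Lemma bmf_indic (A : set T) : measurable A -> bmf (\1_A : T -> R).
Proof.
move=> mA; split; first exact: measurable_indic.
by exists 1 => x; rewrite indicE; case: (x \in A); rewrite ?normr1 ?normr0.
Qed.

Lemma bmf_integrable f : bmf f -> P.-integrable setT (EFin \o f).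
Proof.
move=> [mf [M fM]]; apply: measurable_bounded_integrable => //.
  by rewrite -ge0_fin_numE ?fin_num_measure.
exists M; split; first exact: num_real.
by move=> x Mx y _ /=; exact: le_trans (fM y) (ltW Mx).
Qed.

Definition Ex f : R := \int[P]_x f x.

Lemma ExE f : bmf f -> (Ex f)%:E = (\int[P]_x (f x)%:E)%E.
Proof.
move=> bf; rewrite /Ex /Rintegral fineK//.
exact: integrable_fin_num (bmf_integrable bf).
Qed.

Lemma ExD f g : bmf f -> bmf g -> Ex (fun x => f x + g x) = Ex f + Ex g.
Proof. by move=> bf bg; rewrite /Ex RintegralD//; exact: bmf_integrable. Qed.

Lemma ExZ (r : R) f : bmf f -> Ex (fun x => r * f x) = r * Ex f.
Proof. by move=> bf; rewrite /Ex RintegralZl//; exact: bmf_integrable. Qed.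

Lemma Ex_cst (r : R) : Ex (fun=> r) = r.
Proof. by rewrite /Ex Rintegral_cst//= probability_setT mulr1. Qed.

Lemma Ex_sum (I : Type) (s : seq I) (F : I -> T -> R) :
  (forall i, bmf (F i)) ->
  Ex (fun x => \sum_(i <- s) F i x) = \sum_(i <- s) Ex (F i).
Proof.
move=> bF; elim: s => [|i s IHs].
  by rewrite big_nil -[RHS]Ex_cst; congr Ex; apply/funext => x; rewrite big_nil.
rewrite big_cons -IHs -ExD//; last exact: bmf_sum.
by congr Ex; apply/funext => x; rewrite big_cons.
Qed.

Lemma Ex_ge0 f : (forall x, 0 <= f x) -> 0 <= Ex f.
Proof. by move=> f0; rewrite /Ex; apply: Rintegral_ge0. Qed.

Lemma Ex_le f g : bmf f -> bmf g -> (forall x, f x <= g x) -> Ex f <= Ex g.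
Proof. by move=> bf bg fg; apply: le_Rintegral => //; exact: bmf_integrable. Qed.

Lemma Ex_indic (A : set T) : measurable A -> Ex (\1_A) = pr P A.
Proof.
move=> mA; apply: EFin_inj; rewrite ExE; last exact: bmf_indic.
by rewrite prE// integral_indic// setIT.
Qed.

(** For signs, [f x * g x] is 1 minus twice the indicator of disagreement. *)
Lemma pr_neq f g : measurable_fun setT f -> measurable_fun setT g ->
  (forall x, f x = 1 \/ f x = -1) -> (forall x, g x = 1 \/ g x = -1) ->
  pr P [set x | f x <> g x] = (1 - Ex (fun x => f x * g x)) / 2.
Proof.
move=> mf mg f1 g1; set A := [set x | _].
have mA : measurable A.
  rewrite (_ : A = ~` [set x | f x = g x])//; apply: measurableC.
  exact: measurable_eq_fun.
have -> : (fun x => f x * g x) = (fun x => 1 + -2 * \1_A x).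
  apply/funext => x; rewrite indicE; case: (boolP (x \in A)) => /=.
    by rewrite inE /A/=; have [->|->] := f1 x; have [->|->] := g1 x; lra.
  by rewrite notin_setE => /contrapT ->; have [->|->] := g1 x; lra.
have bA := bmf_indic mA.
rewrite ExD; [|exact: bmf_cst|exact: bmfZ].
by rewrite ExZ// Ex_cst Ex_indic//; lra.
Qed.

End bounded_measurable.
Arguments bmf {d T R} f.

(** * Waves and halfspaces *)

Section dot_product.
Variable R : realType.

(** The sum inside [halfspace]; thus [halfspace w theta x] is [sgn (dotp w x + theta)] by
    conversion. *)
Definition dotp n (w x : n.-tuple R) : R := \sum_(i < n) tnth w i * tnth x i.

Lemma dotp_cons n k (v : n.-tuple R) x (y : n.-tuple R) :
  dotp (tuple_cons (k, v)) (tuple_cons (x, y)) = k * x + dotp v y.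
Proof.
by rewrite /dotp big_ord_recl !tnth0; under eq_bigr do rewrite !tnthS.
Qed.

Lemma measurable_dotp n (w : n.-tuple R) : measurable_fun setT (dotp w).
Proof.
by apply: measurable_sum => i; apply: measurable_funM => //; exact: measurable_tnth.
Qed.

Lemma measurable_dotpD n (w : n.-tuple R) (c : R) :
  measurable_fun setT (fun x => dotp w x + c).
Proof. by apply: measurable_funD => //; exact: measurable_dotp. Qed.

Definition wave n (w : n.-tuple R) (a : R) (x : n.-tuple R) : R :=
  sqwave (dotp w x + a).

Lemma measurable_wave n (w : n.-tuple R) a : measurable_fun setT (wave w a).
Proof. exact: (measurableT_comp (@measurable_sqwave R) (measurable_dotpD w a)). Qed.

Lemma measurable_halfspace n (w : n.-tuple R) a : measurable_fun setT (halfspace w a).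
Proof. exact: (measurableT_comp (@measurable_sgn R) (measurable_dotpD w a)). Qed.

Lemma halfspaceP n (w : n.-tuple R) a x : halfspace w a x = 1 \/ halfspace w a x = -1.
Proof. exact: sgnP. Qed.

Lemma waveP n (w : n.-tuple R) a x : wave w a x = 1 \/ wave w a x = -1.
Proof. exact: sqwaveP. Qed.

Lemma bmf_wave n (w : n.-tuple R) a : bmf (wave w a).
Proof. by apply: bmf_pm1; [exact: measurable_wave|exact: waveP]. Qed.

Lemma bmf_halfspace n (w : n.-tuple R) a : bmf (halfspace w a).
Proof. by apply: bmf_pm1; [exact: measurable_halfspace|exact: halfspaceP]. Qed.

Lemma ge0_integral_gaussian21 n (f : n.+1.-tuple R -> \bar R) :
  measurable_fun setT f -> (forall x, 0 <= f x)%E ->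
  (\int[std_gaussian R n.+1]_z f z =
   \int[std_gaussian R n]_y \int[normal_prob (0 : R) (1 : R)]_x f (tuple_cons (x, y)))%E.
Proof. exact: ge0_integral_tuple_cons21. Qed.

(** On every line parallel to the first axis the wave has frequency [K] and the halfspace is the
    sign of an affine function, so [sqwave_halfline] bounds their agreement there; Tonelli averages
    this over the lines. *)
Lemma wave_neq_halfspace_ge n (K : R) (v : n.-tuple R) a (w : n.+1.-tuple R) th :
  0 < K ->
  1 / 2 - 1 / K <=
  pr (std_gaussian R n.+1) [set x | wave (tuple_cons (K, v)) a x <> halfspace w th x].
Proof.
move=> K0; set A := [set x | wave (tuple_cons (K, v)) a x = halfspace w th x].
have mA : measurable A.
  by apply: measurable_eq_fun; [exact: measurable_wave|exact: measurable_halfspace].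
rewrite (_ : [set x | _] = ~` A)// pr_setC//.
suff : pr (std_gaussian R n.+1) A <= 1 / 2 + 1 / K by lra.
rewrite -lee_fin -Ex_indic// ExE; last exact: bmf_indic.
rewrite ge0_integral_gaussian21//; last first.
- by apply/measurable_EFinP; exact: measurable_indic.
rewrite -(Ex_cst (std_gaussian R n) (1 / 2 + 1 / K)) ExE; last exact: bmf_cst.
apply: ge0_le_integral => //.
- by move=> y _; apply: integral_ge0 => x _; rewrite lee_fin.
- apply: (@measurable_fun_fubini_tonelli_G _ _ _ _ _ (normal_prob (0:R) (1:R))
    (fun z => (\1_A (tuple_cons z))%:E)).
    apply/measurable_EFinP.
    exact: (measurableT_comp (measurable_indic mA) (@measurable_tuple_cons R n)).
  by move=> x; rewrite lee_fin.
move=> y _.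
pose S := [set x : measurableTypeR R |
  sqwave (K * x + (dotp v y + a)) = sgn (thead w * x + (dotp [tuple of behead w] y + th))].
have SE x : A (tuple_cons (x, y)) <-> S x.
  rewrite /A /S /= /wave dotp_cons -addrA.
  suff -> : halfspace w th (tuple_cons (x, y)) =
    sgn (thead w * x + (dotp [tuple of behead w] y + th)) by [].
  by rewrite {1}(tuple_eta w) addrA -dotp_cons.
have mS : measurable S.
  rewrite (_ : S = (fun x => tuple_cons (x, y)) @^-1` A).
    rewrite -[X in measurable X]setTI.
    have : measurable_fun setT (fun x : measurableTypeR R => tuple_cons (x, y)).
      apply: (measurableT_comp (@measurable_tuple_cons R n)).
      exact: measurable_pair2.
    by apply.
  by apply/seteqP; split => x /= /SE.
rewrite (_ : (fun x => _) = (fun x => (\1_S x)%:E)); last first.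
  apply/funext => x; rewrite !indicE; congr ((nat_of_bool _)%:R%:E).
  by apply/idP/idP; rewrite !inE => /SE.
have := sqwave_halfline (dotp v y + a) (thead w) (dotp [tuple of behead w] y + th) K0.
by rewrite -lee_fin -/S prE// integral_indic// setIT.
Qed.

End dot_product.

(** * A halfspace that correlates with a given wave *)

Section correlated_halfspace.
Variable R : realType.

Lemma measurable_l1_ball n (r : R) :
  measurable [set x : n.-tuple R | \sum_(i < n) `|tnth x i| <= r].
Proof.
have mf : measurable_fun setT (fun x : n.-tuple R => \sum_(i < n) `|tnth x i|).
  apply: measurable_sum => i; apply: measurableT_comp => //.
  exact: measurable_tnth.
rewrite [X in measurable X](_ : _ =
    setT `&` (fun x : n.-tuple R => \sum_(i < n) `|tnth x i|) @^-1` `]-oo, r]).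
  by apply: mf.
by rewrite setTI; apply/seteqP; split => x /=; rewrite in_itv.
Qed.

(** The balls exhaust the space, so continuity from below yields a radius. It depends on the measure
    only, so later on the dimension only. *)
Lemma tuple_probability_ball n (P : probability (n.-tuple R) R) :
  exists B : nat, 3 / 4 <= pr P [set x | \sum_(i < n) `|tnth x i| <= B%:R].
Proof.
pose F k := [set x : n.-tuple R | \sum_(i < n) `|tnth x i| <= k%:R].
have mF k : measurable (F k) by exact: measurable_l1_ball.
have FT : \bigcup_k F k = setT.
  apply/seteqP; split => // x _; pose s := \sum_(i < n) `|tnth x i|.
  exists (Num.truncn s).+1 => //=; rewrite /F /= ltW//.
  exact: truncnS_gt.
have ndF : nondecreasing_seq F.
  move=> k l kl; apply/subsetPset => x /=; rewrite /F /= => /le_trans; apply.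
  by rewrite ler_nat.
have h : (P (F k) @[k --> \oo] --> 1%E)%classic.
  rewrite -(probability_setT P) -FT.
  exact: (nondecreasing_cvg_mu mF (bigcup_measurable (fun k _ => mF k)) ndF).
have h34 : 3 / 4 < 1 :> R by lra.
have [N _ /(_ N (leqnn N)) /= hN] := cvgr_gt _ (fine_cvg h) _ h34.
by exists N; exact: ltW.
Qed.

Lemma le_dotp n (w x : n.-tuple R) (K B : nat) :
  (forall i, `|tnth w i| <= K%:R) -> \sum_(i < n) `|tnth x i| <= B%:R ->
  `|dotp w x| <= (B * K)%:R.
Proof.
move=> wK xB; rewrite (le_trans (ler_norm_sum _ _ _))//.
rewrite natrM mulrC; apply: (@le_trans _ _ (\sum_(i < n) K%:R * `|tnth x i|)).
  by apply: ler_sum => i _; rewrite normrM ler_wpM2r.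
by rewrite -mulr_sumr ler_wpM2l.
Qed.

(** An alternating sum [S] of [m] halfspaces is a sign that equals the wave on the ball. Its
    correlation with the wave is thus at least 1/2, and some summand has correlation at least
    [1 / (2 m)] in absolute value. *)
Lemma exists_wave_neq_halfspace_le n (P : probability (n.-tuple R) R)
    (w : n.-tuple R) (K B : nat) :
  (forall i, `|tnth w i| <= K%:R) ->
  3 / 4 <= pr P [set x | \sum_(i < n) `|tnth x i| <= B%:R] ->
  exists a th, pr P [set x | wave w a x <> halfspace w th x] <=
    1 / 2 - 1 / (4 * (4 * (B * K) + 1)%N%:R).
Proof.
move=> wK; set F := [set x | _] => PB.
have mF : measurable F by exact: measurable_l1_ball.
(* On the ball the dot product is at most [B * K] in absolute value, so adding [T] moves it into
   [[0, m)], where [sum_alt_sgn] gives the wave. [T] is even, so the wave is unaffected. *)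
pose T := (B * K).*2; pose m := T.*2.+1.
have mE : (4 * (B * K) + 1)%N = m by rewrite /m /T; lia.
pose h (i : 'I_m) := halfspace w (T%:R - i%:R).
pose S x := \sum_(i < m) (-1) ^+ i * h i x.
have SE x : S x = let u := dotp w x + T%:R in
    if u < 0 then -1 else if m%:R <= u then 1 else sqwave u.
  by rewrite /S /= -sum_alt_sgn; apply: eq_bigr => i _; rewrite -addrA.
have fSF x : F x -> wave w 0 x * S x = 1.
  move=> /(le_dotp wK) /ler_normlP[xl xr]; rewrite SE/= ifF; last first.
    by apply/negbTE; rewrite -leNgt /T -muln2 natrM; lra.
  have TE : T%:R = ((B * K)%N : int)%:~R *+ 2 :> R by rewrite /T -muln2 natrM mulr_natr.
  rewrite ifF; last first.
    by apply/negbTE; rewrite -ltNge /m -natr1 -muln2 natrM /T -muln2 natrM; lra.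
  rewrite TE sqwaveDz /wave addr0.
  by have [->|->] := sqwaveP (dotp w x); lra.
have fS x : -1 <= wave w 0 x * S x.
  have : S x = 1 \/ S x = -1.
    by rewrite SE /=; case: ifP => _; [right|case: ifP => _; [left|exact: sqwaveP]].
  by move=> [->|->]; have [->|->] := waveP w 0 x; lra.
have bh i : bmf (h i) by exact: bmf_halfspace.
have bf := bmf_wave w 0.
have bS : bmf S by apply: bmf_sum => i; exact: bmfZ.
have ES : 1 / 2 <= Ex P (fun x => wave w 0 x * S x).
  (* The product is 1 on the ball and at least -1 elsewhere; with mass 3/4 this gives 3/4 - 1/4. *)
  apply: (@le_trans _ _ (Ex P (fun x => -1 + 2 * \1_F x))).
    rewrite ExD; [|exact: bmf_cst|by apply: bmfZ; exact: bmf_indic].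
    by rewrite Ex_cst ExZ ?Ex_indic//; [lra|exact: bmf_indic].
  apply: Ex_le; [|exact: bmfM|].
    by apply: bmfD; [exact: bmf_cst|apply: bmfZ; exact: bmf_indic].
  move=> x; rewrite indicE; case: (boolP (x \in F)) => [|_]; last by rewrite mulr0 addr0.
  by rewrite inE => /fSF ->; rewrite mulr1; lra.
pose C i := Ex P (fun x => wave w 0 x * h i x).
have ESE : Ex P (fun x => wave w 0 x * S x) = \sum_(i < m) (-1) ^+ i * C i.
  rewrite (_ : (fun x => _) = fun x => \sum_(i < m) (-1) ^+ i * (wave w 0 x * h i x)).
    rewrite Ex_sum; last by move=> i; apply: bmfZ; exact: bmfM.
    by apply: eq_bigr => i _; rewrite ExZ//; exact: bmfM.
  by apply/funext => x; rewrite /S mulr_sumr; apply: eq_bigr => i _; rewrite mulrCA.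
have m0 : 0 < m%:R :> R by rewrite ltr0n.
have [i Ci] : exists i, 1 / (2 * m%:R) <= `|C i|.
  apply/not_existsP => hC.
  suff : Ex P (fun x => wave w 0 x * S x) < 1 / 2 by rewrite ltNge ES.
  rewrite ESE (le_lt_trans (ler_norm _))// (le_lt_trans (ler_norm_sum _ _ _))//.
  have -> : 1 / 2 = \sum_(i < m) 1 / (2 * m%:R) :> R.
    by rewrite sumr_const card_ord -mulr_natr; field; rewrite gt_eqF.
  apply: ltr_sum => [|i _]; first by apply/hasP; exists ord0; rewrite ?mem_index_enum.
  rewrite normrM normrX normrN normr1 expr1n mul1r ltNge.
  by apply/negP => Ci; apply: (hC i); rewrite !mul1r in Ci *.
have e4 : 1 / (4 * m%:R) = 1 / (2 * m%:R) / 2 :> R by field; rewrite gt_eqF.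
rewrite mE e4.
have [Ci0|Ci0] := leP 0 (C i).
  exists 0, (T%:R - i%:R); rewrite pr_neq -/(C i).
  - by move: Ci; rewrite ger0_norm//; lra.
  - exact: measurable_wave.
  - exact: measurable_halfspace.
  - exact: waveP.
  - exact: halfspaceP.
(* A negative correlation becomes positive under the phase 1, which negates the wave. *)
exists 1, (T%:R - i%:R); rewrite pr_neq.
- rewrite (_ : (fun x => _) = fun x => -1 * (wave w 0 x * h i x)).
    by rewrite ExZ -/(C i); [move: Ci; rewrite ltr0_norm//; lra|exact: bmfM].
  by apply/funext => x; rewrite /wave addr0 sqwaveD1 mulN1r mulNr.
- exact: measurable_wave.
- exact: measurable_halfspace.
- exact: waveP.
- exact: halfspaceP.
Qed.

End correlated_halfspace.

(** * Comparison with the uniform measure on the torus *)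

Section periodic.
Variable R : realType.
Local Notation TR := (measurableTypeR R).
Local Notation mu := (@lebesgue_measure R).
Local Notation gamma := (normal_prob (0 : R) (1 : R)).
Local Notation phi := (normal_pdf (0 : R) (1 : R)).

Lemma ltN11 : -1 < 1 :> R. Proof. lra. Qed.

Local Notation unif := (uniform_prob ltN11).

(** The law of this sum under [gamma] times [unif] is the Gaussian smeared over a full period, hence
    uniform modulo 2. *)
Definition conv_pair (p : TR * TR) : TR := p.1 + p.2.

Lemma measurable_conv_pair : measurable_fun setT conv_pair.
Proof. by apply: measurable_funD. Qed.

HB.instance Definition _ :=
  isMeasurableFun.Build _ _ _ _ conv_pair measurable_conv_pair.

Local Notation conv := (distribution (gamma \x unif)%E conv_pair).

Lemma ge0_integral_conv (f : TR -> \bar R) :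
  measurable_fun setT f -> (forall x, 0 <= f x)%E ->
  (\int[conv]_z f z =
   \int[gamma]_x \int[unif]_t f (x + t)%R)%E.
Proof.
move=> mf f0; rewrite ge0_integral_distribution//.
rewrite fubini_tonelli1 => [//||x]; last exact: f0.
exact: (measurableT_comp mf measurable_conv_pair).
Qed.

Lemma ge0_integral_conv21 (f : TR -> \bar R) :
  measurable_fun setT f -> (forall x, 0 <= f x)%E ->
  (\int[conv]_z f z =
   \int[unif]_t \int[gamma]_x f (x + t)%R)%E.
Proof.
move=> mf f0; rewrite ge0_integral_distribution//.
rewrite fubini_tonelli2 => [//||x]; last exact: f0.
exact: (measurableT_comp mf measurable_conv_pair).
Qed.


(** The hypothesis says that the square of [x - t] exceeds that of [x] by at most 1/4, and
    [expR (1 / 8) <= 2]. The slack allows a move of at most 1/2 towards 0 to overshoot 0. *)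
Lemma normal_pdf_le2 (x t : R) : t ^+ 2 <= x * t *+ 2 + 1 / 4 -> phi x <= 2 * phi (x - t).
Proof.
move=> h; rewrite !normal_pdf01E mulrCA ler_wpM2l ?normal_peak_ge0//.
have -> : - x ^+ 2 / 2 = - (x - t) ^+ 2 / 2 + (t ^+ 2 - x * t *+ 2) / 2 by lra.
rewrite expRD mulrC ler_wpM2r ?expR_ge0//.
apply: (@le_trans _ _ (expR (1 / 8))); first by rewrite ler_expR; lra.
have := expR_ge1Dx (- (1 / 8) : R); rewrite expRN => h1.
have e0 := expR_gt0 (1 / 8 : R).
have : (expR (1 / 8))^-1 * expR (1 / 8) = 1 :> R by rewrite mulVf// gt_eqF.
nra.
Qed.

(* Moves towards 0 by at most 1/2 have probability 1/4 under the uniform measure and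
   cost at most a factor 2 in density, hence the constant 8. *)
Lemma normal_le_conv (A : set TR) : measurable A ->
  (gamma A <= mscale (NngNum (ler0n R 8)) (conv) A)%E.
Proof.
move=> mA; rewrite /mscale /=.
have mA1 : measurable_fun setT (\1_A : TR -> R) by exact: measurable_indic.
rewrite [X in (_ <= _ * X)%E](_ : _ =
    (\int[unif]_t \int[gamma]_x (\1_A (x + t)%R)%:E)%E); last first.
  transitivity (\int[conv]_z (\1_A z)%:E)%E.
    by rewrite integral_indic// setIT.
  by rewrite ge0_integral_conv21//; exact/measurable_EFinP.
pose Ap : set TR := A `&` `[0, +oo[%classic.
pose An : set TR := A `\` `[0, +oo[%classic.
have mAp : measurable Ap by exact: measurableI.
have mAn : measurable An by exact: measurableD.
pose Jp : set TR := `[0, 1 / 2]%classic.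
pose Jn : set TR := `[- (1 / 2), 0[%classic.
have mJp : measurable Jp by exact: measurable_itv.
have mJn : measurable Jn by exact: measurable_itv.
have mpre t (B : set TR) : measurable B -> measurable (addR t @^-1` B).
  by move=> mB; rewrite -[X in measurable X]setTI; apply: measurable_addR.
pose cp := pr gamma Ap / 2; pose cn := pr gamma An / 2.
have cp0 : 0 <= cp by rewrite /cp divr_ge0// pr_ge0.
have cn0 : 0 <= cn by rewrite /cn divr_ge0// pr_ge0.
have Jpn t : Jp t -> Jn t -> False by rewrite /Jp /Jn /= !in_itv /=; lra.
(* A [t] in [Jp] moves the nonnegative points of [A] towards 0, a [t] in [Jn] the negative ones;
   either way at least half of the mass of that part is retained. *)
have key t : cp * \1_Jp t + cn * \1_Jn t <= pr gamma (addR t @^-1` A).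
  have half (B : set TR) : measurable B -> B `<=` A ->
      (forall x, B x -> t ^+ 2 <= x * t *+ 2 + 1 / 4) ->
      pr gamma B / 2 <= pr gamma (addR t @^-1` A).
    move=> mB BA h; apply: (@le_trans _ _ (pr gamma (addR t @^-1` B))); last first.
      by apply: pr_le; [exact: mpre|exact: mpre|move=> x; exact: BA].
    have := @normal_prob_shift_le R 2 (- t) B mB (ler0n _ _).
    rewrite opprK -(prE gamma)// -(prE gamma); last exact: mpre.
    rewrite -EFinM lee_fin => h2.
    suff : pr gamma B <= 2 * pr gamma (addR t @^-1` B) by lra.
    by apply: h2 => x Bx; apply: normal_pdf_le2; exact: h.
  rewrite !indicE; case: (boolP (t \in Jp)) => tp; case: (boolP (t \in Jn)) => tn.
  - by rewrite !inE in tp tn; case: (Jpn t).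
  - rewrite mulr1 mulr0 addr0; apply: half => // [x []//|x [_]].
    by move: tp; rewrite inE /Jp /= !in_itv/= => tp x0; nra.
  - rewrite mulr1 mulr0 add0r; apply: half => // [x []//|x [_]].
    by move: tn; rewrite inE /Jn /= !in_itv/= => tn /negP; rewrite andbT -ltNge => x0; nra.
  - by rewrite !mulr0 addr0 pr_ge0.
have bJ : bmf (fun t => cp * \1_Jp t + cn * \1_Jn t : R).
  by apply: bmfD; apply: bmfZ; exact: bmf_indic.
have UJ (J : set TR) : measurable J -> J `<=` `[-1, 1]%classic ->
    mu J = (1 / 2)%:E -> pr unif J = 1 / 4.
  move=> mJ J11 muJ; apply: EFin_inj; rewrite prE//.
  transitivity (\int[mu]_(x in J) (uniform_pdf (-1) 1 x)%:E)%E => //.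
  rewrite (eq_integral (fun=> (1 / 2)%:E)); last first.
    move=> x /[!inE] /J11 /=; rewrite in_itv /= /uniform_pdf => ->.
    by congr EFin; field.
  by rewrite integral_cst//= muJ -EFinM; congr EFin; field.
(* 8 is the factor 2 lost in [cp] and [cn], times 4 for the probability 1/4 of [Jp] and of [Jn]. *)
have -> : gamma A = (8%:E * (Ex unif (fun t => cp * \1_Jp t + cn * \1_Jn t))%:E)%E.
  rewrite ExD; [|by apply: bmfZ; exact: bmf_indic..].
  rewrite !ExZ; [|exact: bmf_indic..].
  rewrite !Ex_indic// !UJ//.
  - rewrite -(prE gamma)// -EFinM; congr EFin.
    rewrite (@pr_setD _ _ _ gamma A `[0, +oo[%classic)// /cp /cn -/Ap -/An.
    by field.
  - by move=> x; rewrite /Jn /= !in_itv /=; lra.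
  - rewrite lebesgue_measure_itv /= lte_fin ifT; last lra.
    by rewrite -EFinD; congr EFin; lra.
  - by move=> x; rewrite /Jp /= !in_itv /=; lra.
  - rewrite lebesgue_measure_itv /= lte_fin ifT; last lra.
    by rewrite -EFinD; congr EFin; lra.
rewrite lee_pmul2l// ExE//.
apply: ge0_le_integral => //.
- by move=> t _; rewrite lee_fin addr_ge0// mulr_ge0.
- by apply/measurable_EFinP; case: bJ.
- apply: (@measurable_fun_fubini_tonelli_G _ _ _ _ _ gamma
    (fun z => (\1_A (z.1 + z.2))%:E)).
    apply/measurable_EFinP.
    exact: (measurableT_comp mA1 measurable_conv_pair).
  by move=> x; rewrite lee_fin.
move=> t _.
rewrite (_ : (fun x => _) = (fun x => (\1_(addR t @^-1` A) x)%:E))//.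
rewrite integral_indic//; last exact: mpre.
rewrite setIT; have := key t; rewrite -lee_fin prE//; exact: mpre.
Qed.

Section one_dim.
Variable G : TR -> \bar R.
Hypothesis mG : measurable_fun setT G.
Hypothesis G0 : (forall x, 0 <= G x)%E.
Hypothesis perG : forall x (m : int), G (x + m%:~R *+ 2) = G x.

(** Modulo 2 the shift is some [t] in [[0, 2)]. The shifted window overhangs by [[1, t + 1)], which
    the period carries onto the missing piece [[-1, t - 1)]. *)
Lemma integral_unif_shift (s : R) :
  (\int[unif]_x G (x + s)%R = \int[unif]_x G x)%E.
Proof.
have mGs t : measurable_fun setT (fun x : TR => G (x + t)).
  exact: (measurableT_comp mG (@measurable_addR R t)).
rewrite !integral_uniform//; congr (_ * _)%E.
have [m ms] := sqwave_bounds (s + 2).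
pose t := s - m%:~R *+ 2 + 2.
have t02 : 0 <= t < 2 by rewrite /t; lra.
have -> : (fun x => G (x + s)%R) = (fun x => G (x + t)%R).
  apply/funext => x; rewrite -(perG (x + t) (m - 1)); congr G.
  by rewrite /t intrB; lra.
rewrite -!integral_itv_bndo_bndc; last 2 first.
- exact: (measurable_funTS (mGs t)).
- exact: (measurable_funTS mG).
transitivity (\int[mu]_(x in `[(t - 1)%R, (t + 1)%R[) G x)%E.
  rewrite [RHS](@ge0_integral_addR R t)//; last exact: (measurable_funTS mG).
  congr integral; apply/seteqP; split => x /=; rewrite /addR !in_itv /=; lra.
have split (a b c : R) : a <= b <= c ->
    (\int[mu]_(x in `[a, c[) G x =
     \int[mu]_(x in `[a, b[) G x + \int[mu]_(x in `[b, c[) G x)%E.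
  move=> abc; rewrite -integral_setU//.
  - congr integral; apply/seteqP; split => x /=; rewrite !in_itv /=.
      by move=> h; have [xb|xb] := ltP x b; [left|right]; lra.
    by move=> []; lra.
  - exact: (measurable_funTS mG).
  - by apply/disj_setPS => x [] /=; rewrite !in_itv /=; lra.
rewrite (@split (t - 1) 1 (t + 1)); last lra.
rewrite (@split (-1) (t - 1) 1); last lra.
rewrite addeC; congr (_ + _)%E.
rewrite (@ge0_integral_addR R 2)//; last exact: (measurable_funTS mG).
rewrite (_ : addR 2 @^-1` `[1, t + 1[ = `[-1, t - 1[%classic); last first.
  by apply/seteqP; split => x /=; rewrite /addR !in_itv /=; lra.
by apply: eq_integral => x _; rewrite -(perG x 1).
Qed.

(** After domination by 8 times [conv], the inner integral over the uniform summand has the same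
    value for every Gaussian summand, by periodicity. *)
Lemma ge0_integral_normal_le : (\int[gamma]_x G x <= 8%:E * \int[unif]_x G x)%E.
Proof.
apply: (@le_trans _ _ (\int[mscale (NngNum (ler0n R 8)) (conv)]_x G x)%E).
  by apply: ge0_le_measure_integral => // A mA; exact: normal_le_conv.
rewrite ge0_integral_mscale// lee_pmul2l//= ge0_integral_conv//.
rewrite (eq_integral (fun=> \int[unif]_x G x)%E); last first.
  by move=> x _; rewrite -(@integral_unif_shift x); apply: eq_integral => t _; rewrite addrC.
by rewrite integral_cst//= probability_setT mule1.
Qed.

End one_dim.

End periodic.

Section torus.
Variable R : realType.
Local Notation TR := (measurableTypeR R).
Local Notation gamma := (normal_prob (0 : R) (1 : R)).
Local Notation unif := (uniform_prob (@ltN11 R)).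

(** Uniform measure on the cube [[-1, 1]^n], which represents the torus (R / 2Z)^n. *)
Fixpoint torus n : probability (n.-tuple R) R :=
  match n with
  | 0 => \d_[tuple]
  | n'.+1 => distribution (unif \x torus n')%E (@tuple_cons R n')
  end.

Definition periodic2 n (T : Type) (G : n.-tuple R -> T) := forall x y : n.-tuple R,
  (forall i, exists m : int, tnth y i = tnth x i + m%:~R *+ 2) -> G y = G x.

Definition addt n (v x : n.-tuple R) : n.-tuple R := [tuple tnth x i + tnth v i | i < n].

Lemma addt_cons n u (v : n.-tuple R) x y :
  addt (tuple_cons (u, v)) (tuple_cons (x, y)) = tuple_cons (x + u, addt v y).
Proof.
apply: eq_from_tnth => i; rewrite tnth_mktuple.
have [j ->|->] := unliftP ord0 i; last by rewrite !tnth0.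
by rewrite !tnthS tnth_mktuple.
Qed.

Lemma measurable_addt n (v : n.-tuple R) : measurable_fun setT (addt v).
Proof.
apply/measurable_fun_tnthP => i.
rewrite (_ : _ \o _ = fun x => tnth x i + tnth v i); last first.
  by apply/funext => x /=; rewrite tnth_mktuple.
by apply: measurable_funD => //; exact: measurable_tnth.
Qed.

Lemma dotp_addt n (w v x : n.-tuple R) : dotp w (addt v x) = dotp w x + dotp w v.
Proof.
by rewrite /dotp -big_split; apply: eq_bigr => i _; rewrite tnth_mktuple mulrDr.
Qed.

Section sections.
Variables (n : nat) (G : n.+1.-tuple R -> \bar R).
Hypothesis mG : measurable_fun setT G.
Hypothesis G0 : (forall x, 0 <= G x)%E.
Hypothesis perG : periodic2 G.

Lemma measurable_tuple_consl (x : TR) :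
  measurable_fun setT (fun y => G (tuple_cons (x, y))).
Proof.
apply: (measurableT_comp mG); apply: (measurableT_comp (@measurable_tuple_cons R n)).
exact: measurable_pair1.
Qed.

Lemma measurable_section_integral (Q : probability (n.-tuple R) R) :
  measurable_fun setT (fun x : TR => \int[Q]_y G (tuple_cons (x, y)))%E.
Proof.
apply: (@measurable_fun_fubini_tonelli_F _ _ _ _ _ Q (fun z => G (tuple_cons z))).
  exact: (measurableT_comp mG (@measurable_tuple_cons R n)).
by move=> z; exact: G0.
Qed.

Lemma periodic2_consl (x : R) : periodic2 (fun y => G (tuple_cons (x, y))).
Proof.
move=> y z yz; apply: perG => i.
have [j ->|->] := unliftP ord0 i; first by rewrite !tnthS.
by exists 0; rewrite !tnth0 mulr0z mul0rn addr0.
Qed.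

Lemma periodic2_consr (x : R) (m : int) y :
  G (tuple_cons (x + m%:~R *+ 2, y)) = G (tuple_cons (x, y)).
Proof.
apply: perG => i; have [j ->|->] := unliftP ord0 i.
  by exists 0; rewrite !tnthS mulr0z mul0rn addr0.
by exists m; rewrite !tnth0.
Qed.

End sections.

Lemma ge0_integral_torus12 n (f : n.+1.-tuple R -> \bar R) :
  measurable_fun setT f -> (forall x, 0 <= f x)%E ->
  (\int[torus n.+1]_z f z = \int[unif]_x \int[torus n]_y f (tuple_cons (x, y)))%E.
Proof. exact: ge0_integral_tuple_cons12. Qed.

Lemma ge0_integral_gaussian12 n (f : n.+1.-tuple R -> \bar R) :
  measurable_fun setT f -> (forall x, 0 <= f x)%E ->
  (\int[std_gaussian R n.+1]_z f z =
   \int[gamma]_x \int[std_gaussian R n]_y f (tuple_cons (x, y)))%E.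
Proof. exact: ge0_integral_tuple_cons12. Qed.

Lemma integral_torus_shift n (G : n.-tuple R -> \bar R) (v : n.-tuple R) :
  measurable_fun setT G -> (forall x, 0 <= G x)%E -> periodic2 G ->
  (\int[torus n]_x G (addt v x) = \int[torus n]_x G x)%E.
Proof.
elim: n G v => [|n IHn] G v mG G0 perG.
  by apply: eq_integral => x _; rewrite [addt v x]tuple0 [x]tuple0.
rewrite ge0_integral_torus12//; last first.
  exact: (measurableT_comp mG (measurable_addt v)).
rewrite [RHS]ge0_integral_torus12//.
rewrite (tuple_eta v); set u := thead v; set v' := [tuple of behead v].
pose H (x : TR) := (\int[torus n]_y G (tuple_cons (x, y)))%E.
transitivity (\int[unif]_x H (x + u)%R)%E.
  apply: eq_integral => x _.
  transitivity (\int[torus n]_y G (tuple_cons ((x + u)%R, addt v' y)))%E.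
    by apply: eq_integral => y _; rewrite -addt_cons.
  rewrite (IHn (fun y => G (tuple_cons ((x + u)%R, y))))//.
    exact: measurable_tuple_consl.
  exact: periodic2_consl.
apply: integral_unif_shift.
- exact: measurable_section_integral.
- by move=> x; apply: integral_ge0.
- by move=> x m; apply: eq_integral => y _; exact: periodic2_consr.
Qed.

(** One factor 8 per coordinate: the integral over the tail is again periodic in the first
    coordinate, so the one-dimensional bound applies to it. *)
Lemma ge0_integral_gaussian_le_torus n (G : n.-tuple R -> \bar R) :
  measurable_fun setT G -> (forall x, 0 <= G x)%E -> periodic2 G ->
  (\int[std_gaussian R n]_x G x <= (8 ^+ n)%:E * \int[torus n]_x G x)%E.
Proof.
elim: n G => [|n IHn] G mG G0 perG; first by rewrite expr0 mul1e.
rewrite ge0_integral_gaussian12//.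
rewrite ge0_integral_torus12//.
pose H (x : TR) := (\int[torus n]_y G (tuple_cons (x, y)))%E.
have mH : measurable_fun setT H by exact: measurable_section_integral.
have H0 x : (0 <= H x)%E by apply: integral_ge0.
apply: (@le_trans _ _ (\int[gamma]_x ((8 ^+ n)%:E * H x))%E).
  apply: ge0_le_integral.
  - exact: measurableT.
  - by move=> x _; apply: integral_ge0.
  - exact: measurable_section_integral.
  - exact: measurable_funeM.
  move=> x _; apply: IHn => //; first exact: measurable_tuple_consl.
  exact: periodic2_consl.
rewrite (@ge0_integralZl _ _ _ gamma _ measurableT H mH (8 ^+ n)%:E (fun x _ => H0 x));
  last first.
  by rewrite lee_fin exprn_ge0.
rewrite exprSr EFinM -muleA; apply: lee_wpmul2l; first by rewrite lee_fin exprn_ge0.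
apply: ge0_integral_normal_le => // x m.
by apply: eq_integral => y _; exact: periodic2_consr.
Qed.

End torus.

(** * Orthogonality of waves *)

Section wave_orthogonality.
Variable R : realType.

Lemma periodic2_wave n (w : n.-tuple R) a :
  (forall i, exists k : int, tnth w i = k%:~R) -> periodic2 (wave w a).
Proof.
move=> wZ x y xy.
pose k i := projT1 (cid (wZ i)); pose m i := projT1 (cid (xy i)).
have -> : wave w a y = sqwave (dotp w x + a + (\sum_(i < n) k i * m i)%:~R *+ 2).
  congr sqwave; rewrite addrAC; congr (_ + a).
  rewrite /dotp rmorph_sum /= -sumrMnl -big_split /=; apply: eq_bigr => i _.
  rewrite (projT2 (cid (xy i))) -/(m i) mulrDr; congr (_ + _).
  by rewrite (projT2 (cid (wZ i))) -/(k i) intrM mulrnAr.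
exact: sqwaveDz.
Qed.

(** Move one coordinate [j] where [v] and [v'] differ, scaled so that the two products differ by 1;
    then use the first coordinate, where both vectors have the entry [K], to bring the second
    product to 0. *)
Lemma exists_separating_shift n (K : R) (v v' : n.-tuple R) : K != 0 -> v != v' ->
  exists u, dotp (tuple_cons (K, v)) u = 1 /\ dotp (tuple_cons (K, v')) u = 0.
Proof.
move=> K0 vv'.
have [j vj] : exists j, tnth v j != tnth v' j.
  apply/not_existsP => h; move/eqP: vv'; apply; apply: eq_from_tnth => i.
  by have /negP/negPn/eqP := h i.
have dj : tnth v j - tnth v' j != 0 by rewrite subr_eq0.
pose t := (tnth v j - tnth v' j)^-1.
pose u' : n.-tuple R := [tuple if i == j then t else 0 | i < n].
have dotu (z : n.-tuple R) : dotp z u' = tnth z j * t.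
  rewrite /dotp (bigD1 j)//= tnth_mktuple eqxx big1 ?addr0// => i /negbTE ij.
  by rewrite tnth_mktuple ij mulr0.
exists (tuple_cons (- (tnth v' j * t) / K, u')).
by split; rewrite dotp_cons dotu /t; field; rewrite ?dj ?K0.
Qed.

(** The separating shift negates the first wave and fixes the second, so the expectation equals its
    own negative. *)
Lemma Ex_torus_wave n (K : R) (v v' : n.-tuple R) a a' : K != 0 -> v != v' ->
  (forall i, exists k : int, tnth (tuple_cons (K, v)) i = k%:~R) ->
  (forall i, exists k : int, tnth (tuple_cons (K, v')) i = k%:~R) ->
  Ex (torus R n.+1)
    (fun x => wave (tuple_cons (K, v)) a x * wave (tuple_cons (K, v')) a' x) = 0.
Proof.
move=> K0 vv' vZ v'Z; have [u [u1 u0]] := exists_separating_shift K0 vv'.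
set f := wave (tuple_cons (K, v)) a; set f' := wave (tuple_cons (K, v')) a'.
have bf : bmf f by exact: bmf_wave.
have bf' : bmf f' by exact: bmf_wave.
have bff : bmf (fun x => f x * f' x) by exact: bmfM.
(* Shift invariance is stated for nonnegative functions, hence the added 1. *)
pose G x := 1 + f x * f' x.
have bG : bmf G by apply: bmfD => //; exact: bmf_cst.
have G0 x : 0 <= G x.
  have [fx|fx] : f x = 1 \/ f x = -1 := waveP _ _ _;
  by have [f'x|f'x] : f' x = 1 \/ f' x = -1 := waveP _ _ _; rewrite /G fx f'x; lra.
have fu x : f (addt u x) = - f x by rewrite /f /wave dotp_addt u1 addrAC sqwaveD1.
have fu' x : f' (addt u x) = f' x by rewrite /f' /wave dotp_addt u0 addr0.
pose G' x := 1 + -1 * (f x * f' x).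
have bG' : bmf G' by apply: bmfD; [exact: bmf_cst|exact: bmfZ].
have : Ex (torus R n.+1) G' = Ex (torus R n.+1) G.
  apply: EFin_inj; rewrite !ExE//.
  rewrite -(@integral_torus_shift R n.+1 (fun x => (G x)%:E) u).
  - by apply: eq_integral => x _; rewrite /G /G' fu fu'; congr EFin; lra.
  - by apply/measurable_EFinP; case: bG.
  - by move=> x; rewrite lee_fin.
  - move=> x y xy; rewrite /G; congr (1 + _)%:E.
    by rewrite /f /f' !(periodic2_wave _ _ xy).
rewrite /G /G' !ExD//; [|exact: bmf_cst..|exact: bmfZ].
by rewrite ExZ//; lra.
Qed.

End wave_orthogonality.

(** * A Bessel inequality under the Gaussian *)

Section bessel.
Variables (R : realType) (n K0 : nat) (K : nat) (a : n.-tuple 'I_K0 -> R).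
Hypothesis K_gt0 : (0 < K)%N.

(** The shared first entry [K] fixes the scale and makes distinct waves separable by a shift; the
    other entries range over [K0 ^ n] choices. The phase [a v] stays arbitrary. *)
Definition freq (v : n.-tuple 'I_K0) : n.+1.-tuple R :=
  tuple_cons (K%:R, map_tuple (fun i : 'I_K0 => (i : nat)%:R) v).

Definition fwave v : n.+1.-tuple R -> R := wave (freq v) (a v).

Lemma freq_int v i : exists k : int, tnth (freq v) i = k%:~R.
Proof.
have [j ->|->] := unliftP ord0 i; last by exists K; rewrite tnth0.
by rewrite tnthS tnth_map; exists (tnth v j : nat).
Qed.

Lemma bmf_fwave v : bmf (fwave v). Proof. exact: bmf_wave. Qed.

Lemma Ex_torus_fwave v v' :
  Ex (torus R n.+1) (fun x => fwave v x * fwave v' x) = (v == v')%:R.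
Proof.
have [<-|vv'] := eqVneq v v'.
  rewrite -[RHS](Ex_cst (torus R n.+1)); congr Ex; apply/funext => x.
  by have [->|->] : fwave v x = 1 \/ fwave v x = -1 := waveP _ _ _; rewrite ?mulrNN mulr1.
apply: Ex_torus_wave; [by rewrite pnatr_eq0 -lt0n| |exact: freq_int|exact: freq_int].
apply: contra_neq vv' => /(congr1 val) /= vv'; apply: val_inj => /=.
by apply: inj_map vv' => i j /eqP; rewrite eqr_nat => /eqP/val_inj.
Qed.

(** [F] combines the waves with their Gaussian coefficients. Orthonormality holds on the torus and
    gives [F] squared norm [S] there; passing to the Gaussian costs the factor [L]. *)
Lemma bessel (q : n.+1.-tuple R -> R) : measurable_fun setT q ->
  (forall x, `|q x| <= 1) ->
  \sum_v (Ex (std_gaussian R n.+1) (fun x => q x * fwave v x)) ^+ 2 <= 8 ^+ n.+1.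
Proof.
move=> mq q1; have bq : bmf q by split=> //; exists 1.
set g := std_gaussian R n.+1; set L : R := 8 ^+ n.+1.
have L0 : 0 < L by rewrite exprn_gt0.
pose c v := Ex g (fun x => q x * fwave v x).
rewrite (eq_bigr (fun v => c v * c v)) => [|v _]; last by rewrite expr2.
set S := \sum_v _.
pose F x := \sum_v c v * fwave v x.
have bcf v : bmf (fun x => c v * fwave v x) by apply: bmfZ; exact: bmf_fwave.
have bF : bmf F by exact: bmf_sum.
have EFF : Ex (torus R n.+1) (fun x => F x * F x) = S.
  transitivity (Ex (torus R n.+1)
      (fun x => \sum_v \sum_v' c v * c v' * (fwave v x * fwave v' x))).
    congr Ex; apply/funext => x; rewrite /F mulr_suml; apply: eq_bigr => v _.
    by rewrite mulr_sumr; apply: eq_bigr => v' _; rewrite mulrACA.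
  have bff v v' : bmf (fun x => fwave v x * fwave v' x).
    by apply: bmfM; exact: bmf_fwave.
  rewrite Ex_sum => [|v]; last by apply: bmf_sum => v'; exact: bmfZ.
  apply: eq_bigr => v _; rewrite Ex_sum => [|v']; last exact: bmfZ.
  rewrite (bigD1 v)//= big1 => [|v' v'v]; rewrite ExZ// Ex_torus_fwave.
    by rewrite eqxx mulr1 addr0.
  by rewrite eq_sym (negbTE v'v) mulr0.
have FF_le : Ex g (fun x => F x * F x) <= L * S.
  rewrite -EFF -lee_fin EFinM !ExE; [|exact: bmfM..].
  apply: ge0_integral_gaussian_le_torus.
  - by apply/measurable_EFinP; case: (bmfM bF bF).
  - by move=> x; rewrite lee_fin -expr2 sqr_ge0.
  - move=> x y xy; suff -> : F y = F x by [].
    apply: eq_bigr => v _; congr (_ * _).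
    exact: (periodic2_wave _ (freq_int v)).
have qF : Ex g (fun x => q x * F x) = S.
  transitivity (Ex g (fun x => \sum_v c v * (q x * fwave v x))).
    by congr Ex; apply/funext => x; rewrite mulr_sumr; apply: eq_bigr => v _; rewrite mulrCA.
  have bqf v : bmf (fun x => q x * fwave v x) by apply: bmfM => //; exact: bmf_fwave.
  rewrite Ex_sum => [|v]; last exact: bmfZ.
  by apply: eq_bigr => v _; rewrite ExZ.
have qq : Ex g (fun x => q x * q x) <= 1.
  rewrite -[leRHS](Ex_cst g); apply: Ex_le; [exact: bmfM|exact: bmf_cst|].
  by move=> x; rewrite -expr2 -real_normK ?num_real// expr_le1.
(* Expanded with [FF_le], [qF] and [qq], this square gives [0 <= L * S - 2 * L * S + L ^ 2], that is
   [S <= L]. *)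
have : 0 <= Ex g (fun x => (F x - L * q x) ^+ 2) by apply: Ex_ge0 => x; exact: sqr_ge0.
rewrite (_ : (fun x => _ ^+ 2) =
    fun x => F x * F x + (- L *+ 2 * (q x * F x) + L ^+ 2 * (q x * q x))); last first.
  by apply/funext => x; ring.
have bFF : bmf (fun x => F x * F x) by exact: bmfM.
have bqF : bmf (fun x => q x * F x) by exact: bmfM.
have bqq : bmf (fun x => q x * q x) by exact: bmfM.
rewrite ExD//; last by apply: bmfD; exact: bmfZ.
rewrite ExD; [|exact: bmfZ..]; rewrite !ExZ// qF => h.
have : 0 <= L * (L - S).
  have : L ^+ 2 * Ex g (fun x => q x * q x) <= L ^+ 2 * 1 by rewrite ler_wpM2l ?sqr_ge0.
  by move: h FF_le; clear; lra.
by rewrite pmulr_rge0// subr_ge0.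
Qed.

(** Each counted wave contributes at least [tau ^ 2] to the Bessel sum. *)
Lemma card_correlated (q : n.+1.-tuple R -> R) (tau : R) : measurable_fun setT q ->
  (forall x, `|q x| <= 1) -> 0 < tau ->
  #|[pred v | tau < `|Ex (std_gaussian R n.+1) (fun x => q x * fwave v x)|]|%:R <=
  8 ^+ n.+1 / tau ^+ 2.
Proof.
move=> mq q1 t0; rewrite ler_pdivlMr ?exprn_gt0//.
apply: le_trans (bessel mq q1).
set B := SimplPred _; rewrite mulr_natl -sumr_const.
rewrite [leRHS](bigID (mem B))/= -[leLHS]addr0 lerD//.
  apply: ler_sum => v; rewrite inE => tv.
  by rewrite -[leRHS]real_normK ?num_real// ler_sqr ?nnegrE// ltW.
by apply: sumr_ge0 => v _; exact: sqr_ge0.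
Qed.

End bessel.

(** * Statistical queries *)

Section distance.
Variables (R : realType) (n : nat).
Implicit Types f : n.-tuple R -> R.

Lemma dist_halfspaces_ge f (c : R) :
  (forall w th, c <= pr (std_gaussian R n) [set x | f x <> halfspace w th x]) ->
  c <= dist_halfspaces f.
Proof.
move=> h; apply: lb_le_inf => [|_ [_ [w [th ->]] <-]]; last exact: h.
exists (pr (std_gaussian R n) [set x | f x <> halfspace [tuple 0 | i < n] 0 x]).
by exists (halfspace [tuple 0 | i < n] 0) => //; exists [tuple 0 | i < n], 0.
Qed.

Lemma dist_halfspaces_le f w th :
  dist_halfspaces f <= pr (std_gaussian R n) [set x | f x <> halfspace w th x].
Proof.
apply: ge_inf; first by exists 0 => _ [h _ <-]; exact: pr_ge0.
by exists (halfspace w th) => //; exists w, th.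
Qed.

End distance.

Section reference_run.
Variables (R : realType) (n : nat) (tau : R).
Hypothesis tau_ge0 : 0 <= tau.
Implicit Types (q : sq_query R n) (f : n.-tuple R -> R).
Local Notation g := (std_gaussian R n).

(** The expected value of [q (x, y)] for [y] a uniform random sign independent of [x]. The deviation
    for an actual [f] is the correlation of [f] with [query_odd q]. *)
Definition ref_answer q : R := Ex g (fun x => (q (x, 1) + q (x, -1)) / 2).
Definition query_odd q x : R := (q (x, 1) - q (x, -1)) / 2.
Definition uninformative f q : bool := `|Ex g (fun x => query_odd q x * f x)| <= tau.

Lemma query_slice q (y : R) : y \in `[-1, 1] ->
  measurable_fun setT (fun x => q (x, y)) /\ forall x, `|q (x, y)| <= 1.
Proof.
move=> y1; split=> [|x]; last first.
  by have := @sq_fun_bounded _ _ q x y y1; rewrite in_itv /= ler_norml.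
apply: (measurable_comp _ _ (@sq_fun_measurable _ _ q)) => //.
- rewrite [X in measurable X](_ : _ =
      setT `&` snd @^-1` (`[-1, 1]%classic : set R)); last first.
    by rewrite setTI; apply/seteqP; split.
  by apply: (@measurable_snd _ _ (n.-tuple R) R measurableT).
- by move=> _ [x _ <-].
Qed.

Lemma query_odd_bounded q : measurable_fun setT (query_odd q) /\
  forall x, `|query_odd q x| <= 1.
Proof.
have [m1 b1] : _ /\ _ := @query_slice q 1 ltac:(by rewrite in_itv /=; lra).
have [m2 b2] : _ /\ _ := @query_slice q (-1) ltac:(by rewrite in_itv /=; lra).
split=> [|x]; first by apply: measurable_funM => //; exact: measurable_funB.
have /ler_normlP[h1 h2] := b1 x; have /ler_normlP[h3 h4] := b2 x.
by rewrite /query_odd; apply/ler_normlP; split; lra.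
Qed.

Lemma stat_answer_ref f q : measurable_fun setT f -> sign_valued f ->
  uninformative f q -> stat_answer tau f q (ref_answer q).
Proof.
move=> mf f1 fq.
have [m1 b1] : _ /\ _ := @query_slice q 1 ltac:(by rewrite in_itv /=; lra).
have [m2 b2] : _ /\ _ := @query_slice q (-1) ltac:(by rewrite in_itv /=; lra).
have B1 : bmf (fun x => q (x, 1)) by split=> //; exists 1.
have B2 : bmf (fun x => q (x, -1)) by split=> //; exists 1.
have [mo bo] := query_odd_bounded q.
have Bf : bmf f by exact: bmf_pm1.
have Bo : bmf (fun x => query_odd q x * f x) by apply: bmfM => //; split=> //; exists 1.
rewrite /stat_answer -/(Ex g (fun x => q (x, f x))).
have -> : (fun x => q (x, f x)) =
    fun x => (q (x, 1) + q (x, -1)) / 2 + query_odd q x * f x.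
  by apply/funext => x; rewrite /query_odd; have [->|->] := f1 x; lra.
rewrite ExD//; last by apply: (bmfM (bmfD B1 B2)); exact: bmf_cst.
by rewrite -/(ref_answer q) addrAC subrr add0r.
Qed.

(** The first [N] queries on the path of reference answers. They do not depend on the unknown
    function, which may therefore be chosen after them. *)
Fixpoint ref_queries N (A : sq_alg R n) : seq (sq_query R n) :=
  match N, A with
  | N'.+1, Query q next => q :: ref_queries N' (next (ref_answer q))
  | _, _ => [::]
  end.

Lemma size_ref_queries N A : (size (ref_queries N A) <= N)%N.
Proof. by elim: N A => [|N IHN] [out|q next] //=; exact: IHN. Qed.

Lemma exists_sq_run f A : exists out m, sq_run tau f A out m.
Proof.
elim: A => [out|q next IH]; first by exists out, 0%N; exact: RunOutput.
have [out [m r]] := IH (\int[g]_x q (x, f x)).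
exists out, m.+1; apply: RunQuery r.
by rewrite /stat_answer subrr normr0.
Qed.

(** On the reference path the algorithm either stops before its [N]th query, with one output for all
    uninformative functions, or makes [N] queries, after which exact answers complete the run. *)
Lemma ref_run N A :
  (exists out, forall f, measurable_fun setT f -> sign_valued f ->
    all (uninformative f) (ref_queries N A) -> exists m, sq_run tau f A out m) \/
  (forall f, measurable_fun setT f -> sign_valued f ->
    all (uninformative f) (ref_queries N A) ->
    exists out m, (N <= m)%N /\ sq_run tau f A out m).
Proof.
elim: N A => [|N IHN] A.
  by right=> f _ _ _; have [out [m r]] := exists_sq_run f A; exists out, m.
case: A => [out|q next]; first by left; exists out => f _ _ _; exists 0%N; exact: RunOutput.
case: (IHN (next (ref_answer q))) => [[out h]|h]; [left; exists out|right];
  move=> f mf f1 /= /andP[fq fs].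
  have [m r] := h f mf f1 fs; exists m.+1; apply: RunQuery r.
  exact: stat_answer_ref.
have [out [m [Nm r]]] := h f mf f1 fs; exists out, m.+1; split=> //.
by apply: RunQuery r; exact: stat_answer_ref.
Qed.

End reference_run.

(** Union bound. *)
Lemma card_not_all (I : finType) (T : Type) (P : I -> pred T) (s : seq T) :
  (#|[pred i | ~~ all (P i) s]| <= \sum_(t <- s) #|[pred i | ~~ P i t]|)%N.
Proof.
elim: s => [|t s IHs]; first by rewrite big_nil eq_card0.
rewrite big_cons; apply: leq_trans (leq_add (leqnn _) IHs).
rewrite -cardUI; apply: leq_trans (leq_addr _ _).
by apply: subset_leq_card; apply/fintype.subsetP => i; rewrite !inE /= negb_and.
Qed.

Section hidden_wave.
Variables (R : realType) (n : nat).
Local Notation g := (std_gaussian R n.+1).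

(** Each query in [s] detects at most [8 ^+ n.+1 / tau ^+ 2] of the [K0 ^ n] waves, so by the size
    hypothesis some wave escapes all of them. *)
Lemma exists_hidden_wave (B K0 K : nat) (tau : R) (s : seq (sq_query R n.+1)) :
  3 / 4 <= pr g [set x | \sum_(i < n.+1) `|tnth x i| <= B%:R] ->
  (0 < K0)%N -> (K0 <= K)%N -> 0 < tau ->
  (size s)%:R * (8 ^+ n.+1 / tau ^+ 2) < K0%:R ^+ n ->
  exists f : n.+1.-tuple R -> R, [/\ measurable_fun setT f, sign_valued f,
    all (uninformative tau f) s,
    1 / 2 - 1 / K%:R <= dist_halfspaces f &
    dist_halfspaces f <= 1 / 2 - 1 / (4 * (4 * (B * K) + 1)%N%:R)].
Proof.
move=> hB K00 K0K tau0 hs.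
have K_gt0 : (0 < K)%N by exact: leq_trans K0K.
(* Every wave receives in advance the phase that makes it correlate with a halfspace; the Bessel
   bound holds for any phases. *)
have /choice[a ha] (v : n.-tuple 'I_K0) : exists a : R, exists th,
    pr g [set x | wave (freq R K v) a x <> halfspace (freq R K v) th x] <=
    1 / 2 - 1 / (4 * (4 * (B * K) + 1)%N%:R).
  apply: exists_wave_neq_halfspace_le => // i.
  have [j ->|->] := unliftP ord0 i; last by rewrite tnth0 normr_nat.
  by rewrite tnthS tnth_map normr_nat ler_nat (leq_trans (ltnW (ltn_ord _))).
have [v hv] : exists v, all (uninformative tau (fwave K a v)) s.
  apply/not_existsP => h; move: hs; apply/negP; rewrite -leNgt.
  have cardT : #|[pred v | ~~ all (uninformative tau (fwave K a v)) s]| = (K0 ^ n)%N.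
    rewrite -[in RHS](card_ord K0) -card_tuple; apply: eq_card => v.
    by rewrite !inE; apply/negP; exact: h.
  rewrite -natrX -cardT.
  apply: (@le_trans _ _ (\sum_(q <- s) #|[pred v | ~~ uninformative tau (fwave K a v) q]|)%:R).
    by rewrite ler_nat; exact: card_not_all.
  rewrite natr_sum.
  apply: (@le_trans _ _ (\sum_(q <- s) 8 ^+ n.+1 / tau ^+ 2)); last first.
    by rewrite big_const_seq count_predT iter_addr addr0 mulr_natl.
  apply: ler_sum => q _.
  have [mo bo] := query_odd_bounded q.
  apply: le_trans (card_correlated a K_gt0 mo bo tau0).
  rewrite ler_nat; apply: subset_leq_card; apply/fintype.subsetP => v.
  by rewrite !inE /uninformative -ltNge.
exists (fwave K a v); split=> //.
- exact: measurable_wave.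
- by move=> x; exact: waveP.
- by apply: dist_halfspaces_ge => w th; apply: wave_neq_halfspace_ge; rewrite ltr0n.
- by have [th] := ha v; apply: le_trans; exact: dist_halfspaces_le.
Qed.

End hidden_wave.

(** * Arithmetic of the parameters *)

(** With [Y] the eighth root of [1 / eps], the queries and [tau ^ -2] cost [Y ^ (3 (n + 1))] up to a
    constant absorbed by [Y ^ 2], against [Y ^ (8 n)] waves up to [M ^ n]. The comparison
    [3 n + 5 <= 8 n] holds for [n >= 1], that is for dimension at least 2. *)
Lemma count_bound (R : realType) (n b N K0 : nat) (Y M : R) : (0 < n)%N ->
  1 <= Y -> 0 < M -> 2 ^+ b.+1 * 8 ^+ n.+1 * M ^+ n < Y ^+ 2 ->
  N%:R <= Y ^+ n.+1 -> Y ^+ 8 / M <= K0%:R ->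
  (2 ^ b * N.+1)%N%:R * (8 ^+ n.+1 / ((Y ^+ n.+1)^-1) ^+ 2) < K0%:R ^+ n.
Proof.
move=> n0 Y1 M0 hY hN hK.
have Y0 : 0 < Y by lra.
have Yk k : 1 <= Y ^+ k by rewrite exprn_ege1.
apply: (@lt_le_trans _ _ ((Y ^+ 8 / M) ^+ n)); last first.
  by rewrite lerXn2r// nnegrE ?divr_ge0 ?exprn_ge0// ltW.
rewrite expr_div_n ltr_pdivlMr ?exprn_gt0// exprVn invrK -!exprM.
rewrite natrM natrX -natr1.
apply: (@le_lt_trans _ _ (2 ^+ b * (2 * Y ^+ n.+1) *
    (8 ^+ n.+1 * Y ^+ (n.+1 * 2)) * M ^+ n)).
  rewrite ler_wpM2r ?exprn_ge0// ?(ltW M0)// ler_wpM2r//.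
    by rewrite mulr_ge0 ?exprn_ge0// ltW.
  by rewrite ler_wpM2l ?exprn_ge0//; have := Yk n.+1; lra.
rewrite [ltLHS](_ : _ = (2 ^+ b.+1 * 8 ^+ n.+1 * M ^+ n) * Y ^+ (n.+1 * 3)); last first.
  by rewrite [2 ^+ b.+1]exprS [(n.+1 * 3)%N]mulnSr [Y ^+ (_ + _)]exprD; ring.
apply: (@lt_le_trans _ _ (Y ^+ 2 * Y ^+ (n.+1 * 3))).
  by rewrite ltr_pM2r// exprn_gt0.
by rewrite -exprD ler_weXn2l//; lia.
Qed.

(** The coarser wave is at least [1 / (D Kj)] below 1/2, the finer one at most half of that; the
    remaining half exceeds [2 eps]. *)
Lemma dist_gap (R : realType) (D Kj Kk eps x y : R) : 0 < D -> 0 < Kj ->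
  2 * D * Kj <= Kk -> 4 * D * Kj * eps < 1 -> 0 < eps ->
  x <= 1 / 2 - 1 / (D * Kj) -> 1 / 2 - 1 / Kk <= y -> 2 * eps < y - x.
Proof.
move=> D0 Kj0 hK he e0 hx hy.
have DK : 0 < D * Kj by rewrite mulr_gt0.
have h1 : 1 / Kk <= 1 / (D * Kj) / 2.
  rewrite -mulrA !mul1r -invfM lef_pV2 ?posrE; nra.
have h2 : 2 * eps < 1 / (D * Kj) / 2.
  rewrite -mulrA mul1r -invfM -[ltRHS]mul1r ltr_pdivlMr; nra.
by move: hx hy h1 h2; clear; lra.
Qed.

Lemma scale_bound (R : realType) (M K e x : R) : 0 < M -> 0 < e ->
  K <= 2 * (1 / e / M) -> x <= M / 4 * K -> x * e < 1.
Proof.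
move=> M0 e0 hK hx.
have h : M / 4 * K * e <= 1 / 2.
  have -> : 1 / 2 = M / 4 * (2 * (1 / e / M)) * e by field; rewrite !gt_eqF.
  by rewrite ler_wpM2r ?(ltW e0)// ler_wpM2l//; lra.
have := ler_wpM2r (ltW e0) hx; lra.
Qed.

Lemma common_answer_gap (R : realType) (x y out e : R) :
  `|x - out| <= e -> `|y - out| <= e -> 2 * e < y - x -> False.
Proof. by move=> /ler_normlP[? ?] /ler_normlP[? ?]; lra. Qed.

(** * The query lower bound *)

Theorem theorem5p11 (R : realType) :
  exists c1 c2 : R, 0 < c1 /\ 0 < c2 /\
    forall d : nat, (2 <= d)%N ->
    forall b : nat,
    exists eps0 : R, 0 < eps0 /\
      forall eps : R, 0 < eps -> eps < eps0 ->
      forall (A : b.-tuple bool -> sq_alg R d) (N : nat),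
        sq_dist_approx A eps (eps `^ (c2 * d%:R)) N ->
        (1 / eps) `^ (c1 * d%:R) <= N%:R.
Proof.
exists (1 / 8), (1 / 8); split; first lra; split; first lra.
case=> [//|n] n1 b.
have [B hB] := tuple_probability_ball (std_gaussian R n.+1).
(* [D * K] bounds the denominator [4 * (4 * (B * K) + 1)] for positive [K], and [L + 1] scales
   exceed the [2 ^ b] advice strings. With ratio [2 * D] between scales, [M] is such that [4 * D]
   times the top scale equals [M / 4 * K0]. *)
pose D := (4 * (4 * B + 1))%N; pose L := (2 ^ b)%N.
pose M := (16 * D * (2 * D) ^ L)%N.
have D_gt0 : (0 < D)%N by rewrite /D; lia.
have D2_gt1 : (1 < 2 * D)%N by rewrite /D; lia.
have D2_gt0 : (0 < 2 * D)%N by exact: ltnW.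
have DK k : (0 < k)%N -> (4 * (4 * (B * k) + 1) <= D * k)%N by rewrite /D; nia.
have M_gt0 : (0 < M)%N by rewrite muln_gt0 muln_gt0 D_gt0 expn_gt0 D2_gt0.
pose C : R := 2 ^+ b.+1 * 8 ^+ n.+1 * M%:R ^+ n.
have C1 : 1 <= C.
  by apply: mulr_ege1; [apply: mulr_ege1|]; rewrite exprn_ege1// ler1n.
have M1 : 1 <= M%:R :> R by rewrite ler1n.
(* Below this threshold [Y ^ 8 = 1 / eps] exceeds [C ^ 4], whence [C < Y ^ 2], and [1 / eps] exceeds
   [M], whence [K0] is positive. *)
exists (1 / (M%:R * C ^+ 4)); split.
  by rewrite divr_gt0// mulr_gt0 ?exprn_gt0//; lra.
move=> eps e0 eps_lt A N hA.
pose Y := (1 / eps) `^ (1 / 8).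
have X0 : 0 < 1 / eps by rewrite divr_gt0.
have hX : M%:R * C ^+ 4 < 1 / eps.
  have Z0 : 0 < M%:R * C ^+ 4 by rewrite mulr_gt0 ?exprn_gt0//; lra.
  by rewrite ltr_pdivlMr// mulrC -ltr_pdivlMr.
have Y8 : Y ^+ 8 = 1 / eps.
  rewrite -powR_mulrn ?powR_ge0// -powRrM divfK; last by rewrite pnatr_eq0.
  by rewrite powRr1// ltW.
have XE : (1 / eps) `^ (1 / 8 * n.+1%:R) = Y ^+ n.+1.
  by rewrite powRrM powR_mulrn// powR_ge0.
have tE : eps `^ (1 / 8 * n.+1%:R) = (Y ^+ n.+1)^-1.
  rewrite -XE; set r := _ * _.
  have Xr : (1 / eps) `^ r != 0 by rewrite gt_eqF// powR_gt0.
  rewrite -[LHS](mulfK Xr) -powRM ?(ltW e0) ?(ltW X0)//.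
  by rewrite mul1r divff ?gt_eqF// powR1 mul1r.
rewrite XE; rewrite tE in hA.
rewrite leNgt; apply/negP => hN.
have Y0 : 0 < Y by rewrite powR_gt0.
have C4 : 1 <= C ^+ 4 by rewrite exprn_ege1.
have Y1 : 1 <= Y.
  rewrite leNgt; apply/negP => Yl; have : Y ^+ 8 <= 1 by rewrite exprn_ile1// ltW.
  by rewrite Y8 leNgt; apply/negP; nra.
have CY : C < Y ^+ 2.
  rewrite -(@ltr_pXn2r _ 4)// ?nnegrE ?exprn_ge0 ?ltW//; last lra.
  by rewrite -exprM Y8; nra.
(* Truncating twice [Y ^ 8 / M], which is at least 2, leaves [K0] between [Y ^ 8 / M] and its
   double. *)
pose K0 := Num.truncn (Y ^+ 8 / (M%:R / 2)).
have XM : 1 <= Y ^+ 8 / M%:R by rewrite ler_pdivlMr ?mul1r ?Y8; nra.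
have z2 : Y ^+ 8 / (M%:R / 2) = 2 * (Y ^+ 8 / M%:R) by field; lra.
have z0 : 0 <= Y ^+ 8 / (M%:R / 2) by lra.
have K0l : K0%:R <= 2 * (Y ^+ 8 / M%:R) by rewrite -z2 truncn_le.
have K0g : Y ^+ 8 / M%:R <= K0%:R.
  by have := truncnS_gt (Y ^+ 8 / (M%:R / 2)); rewrite -/K0 -natr1 z2; lra.
have K00 : (0 < K0)%N by rewrite -(ltr_nat R); lra.
pose tau := (Y ^+ n.+1)^-1; have tau0 : 0 < tau by rewrite invr_gt0 exprn_gt0.
(* The reference queries for all advice strings are pooled, so the hidden waves can be chosen before
   their advice is known. [N.+1] queries are taken because making that many contradicts the bound
   [N]. *)
pose s := flatten [seq ref_queries N.+1 (A a) | a <- enum {: b.-tuple bool}].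
have size_s : (size s <= 2 ^ b * N.+1)%N.
  rewrite size_flatten /shape -map_comp sumnE big_map big_enum /=.
  apply: (@leq_trans (\sum_(a : b.-tuple bool) N.+1)).
    by apply: leq_sum => a _; exact: size_ref_queries.
  by rewrite sum_nat_const card_tuple card_bool.
have hs : (size s)%:R * (8 ^+ n.+1 / tau ^+ 2) < K0%:R ^+ n.
  apply: le_lt_trans (@count_bound R n b N K0 Y M%:R _ Y1 _ CY (ltW hN) K0g) => //; last lra.
  rewrite ler_wpM2r ?ler_nat// divr_ge0 ?exprn_ge0//.
  exact: ltW.
pose K k := ((2 * D) ^ k * K0)%N.
have K0K k : (K0 <= K k)%N by rewrite /K leq_pmull// expn_gt0 D2_gt0.
have /choice[f hf] (k : 'I_L.+1) := exists_hidden_wave hB K00 (K0K k) tau0 hs.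
have /choice[adv hadv] (k : 'I_L.+1) : exists a, forall out m,
    sq_run tau (f k) (A a) out m -> `|dist_halfspaces (f k) - out| <= eps /\ (m <= N)%N.
  by have [mf f1 _ _ _] := hf k; exact: hA.
(* Pigeonhole: there are [2 ^ b + 1] scales and [2 ^ b] advice strings. *)
have [j [k [jk ajk]]] : exists j k : 'I_L.+1, (j < k)%N /\ adv j = adv k.
  apply/not_existsP => h.
  suff /leq_card : injective adv by rewrite card_ord card_tuple card_bool ltnn.
  move=> i1 i2 e; apply: val_inj => /=.
  have [lt12|lt21|//] := ltngtP (i1 : nat) (i2 : nat).
    by case: (h i1); exists i2.
  by case: (h i2); exists i1.
have good i : all (uninformative tau (f i)) (ref_queries N.+1 (A (adv i))).
  have [_ _ + _ _] := hf i; rewrite /s; move: (mem_enum predT (adv i)); rewrite inE.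
  elim: (enum _) => [//|a l IHl]; rewrite inE /= all_cat.
  by move=> /orP[/eqP ->|/IHl h] /andP[].
have gap : 2 * eps < dist_halfspaces (f k) - dist_halfspaces (f j).
  have [_ _ _ _ hj] := hf j; have [_ _ _ hk _] := hf k.
  have Kj0 : (0 < K j)%N by exact: leq_trans (K0K j).
  apply: (@dist_gap R D%:R (K j)%:R (K k)%:R) => //.
  - by rewrite ltr0n.
  - by rewrite ltr0n.
  - rewrite -!natrM ler_nat /K mulnA -expnS leq_mul2r leq_exp2l ?jk ?orbT//.
  - have hM : 4 * D%:R * (K j)%:R <= M%:R / 4 * K0%:R :> R.
      rewrite [leRHS](_ : _ = (4 * D * (2 * D) ^ L * K0)%N%:R).
        rewrite -!natrM ler_nat /K mulnA leq_mul2r leq_mul2l; apply/orP; right.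
        by rewrite leq_pexp2l ?orbT// -ltnS ltn_ord.
      by rewrite /M !natrM; field.
    apply: (@scale_bound R M%:R K0%:R) hM => //; first by rewrite ltr0n.
    by rewrite -Y8.
  apply: le_trans hj _; rewrite lerD2l lerN2 !mul1r lef_pV2 ?posrE.
  - by rewrite -!natrM ler_nat; exact: DK.
  - by rewrite -natrM ltr0n muln_gt0 D_gt0.
  - by rewrite -natrM ltr0n muln_gt0 addn1.
have [mj fj _ _ _] := hf j; have [mk fk _ _ _] := hf k.
have gj := good j; have gk := good k; rewrite -ajk in gk.
(* Either both waves admit the same output, against [gap], or some run makes more than [N]
   queries. *)
have [[out run]|run] := ref_run (ltW tau0) N.+1 (A (adv j)).
  have [m1 /hadv[dj _]] := run _ mj fj gj.
  have [m2] := run _ mk fk gk; rewrite ajk => /hadv[dk _].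
  exact: common_answer_gap dj dk gap.
have [out [m [Nm /hadv[_ mN]]]] := run _ mj fj gj.
by move: Nm; rewrite ltnNge mN.
Qed.
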